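(* Let $r>0$, $\sigma>0$, $0<\alpha<1$, $\bar\alpha=-\log(1-\alpha)$. Let $V_1,\tilde V_1,V_2,\tilde V_2$ be the prices, as functions of the maturity $T$, of the four relative-drawdown insurance contracts defined in the context. For every $\lambda>0$, $$\int_0^\infty e^{-\lambda T}V_1(T)\,dT=\frac{1}{\lambda+r}\,\frac{\bar c_{\lambda+r}/\bar b_{\lambda+r}}{1-\bar c_{\lambda+r}/\bar b_{\lambda+r}},\qquad \int_0^\infty e^{-\lambda T}\tilde V_1(T)\,dT=\frac{1}{\lambda+r}\,\frac{\bar c_{\lambda+r}/\bar b_{\lambda+r}}{1-e^{-\bar\beta^+_{\lambda+r}\bar\alpha}\,\bar c_{\lambda+r}/\bar b_{\lambda+r}},$$ $$\int_0^\infty e^{-\lambda T}V_2(T)\,dT=\frac{1}{\lambda}\,\frac{\bar c_{\lambda+r}/\bar b_{\lambda+r}}{1-\bar c_{\lambda+r}/\bar b_{\lambda+r}},\qquad \int_0^\infty e^{-\lambda T}\tilde V_2(T)\,dT=\frac{1}{\lambda}\,\frac{\bar c_{\lambda+r}/\bar b_{\lambda+r}}{1-e^{-\bar\beta^+_{\lambda+r}\bar\alpha}\,\bar c_{\lambda+r}/\bar b_{\lambda+r}},$$ where, for $q>0$, $\bar\beta_q^{\pm}=\dfrac{-r+\frac12\sigma^2\pm\sqrt{(r-\frac12\sigma^2)^2+2q\sigma^2}}{\sigma^2}$, $\ \bar b_q=\dfrac{\bar\beta_q^+e^{-\bar\beta_q^-\bar\alpha}-\bar\beta_q^-e^{-\bar\beta_q^+\bar\alpha}}{e^{-\bar\beta_q^-\bar\alpha}-e^{-\bar\beta_q^+\bar\alpha}}$,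 $\ \bar c_q=\dfrac{\bar\beta_q^+-\bar\beta_q^-}{e^{-\bar\beta_q^-\bar\alpha}-e^{-\bar\beta_q^+\bar\alpha}}$.
   Context: Under a risk-neutral measure $\mathbb{Q}$ the asset price is $S_t=s_0e^{X_t}$ with $X_t=(r-\frac12\sigma^2)t+\sigma W_t^{\mathbb{Q}}$, $W^{\mathbb{Q}}$ a standard $\mathbb{Q}$-Brownian motion, $s_0>0$. A relative drawdown of $S$ of size $\alpha$ (a fall of $S$ by the fraction $\alpha$ from its running maximum) is the same as a drawdown of $X$ of size $\bar\alpha=-\log(1-\alpha)$. With $M_t=\sup_{0\le s\le t}X_s$, $M_{[s,t]}=\sup_{s\le u\le t}X_u$, $\inf\emptyset=\infty$, define for $n\ge1$: without recovery, $\tau^0=0$, $\tau^n=\inf\{t>\tau^{n-1}:M_{[\tau^{n-1},t]}-X_t\ge\bar\alpha\}$; with recovery, $\tilde\tau^0=0$, $\tilde\tau^n=\inf\{t>\tilde\tau^{n-1}:M_t-X_t\ge\bar\alpha,\ M_t>M_{\tilde\tau^{n-1}}\}$ (and $\tilde\tau^n=\infty$ if $\tilde\tau^{n-1}=\infty$). Let $N_T=\sum_{n\ge1}1_{\{\tau^n\le T\}}$ and $\tilde N_T=\sum_{n\ge1}1_{\{\tilde\tau^n\le T\}}$. Contract prices for maturity $T$: type 1 pays at $T$ the number of drawdowns up to $T$, $$V_1(T)=e^{-rT}\mathbb{E}^{\mathbb{Q}}[N_T],\qquad \tilde V_1(T)=e^{-rT}\mathbb{E}^{\mathbb{Q}}[\tilde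 N_T];$$ type 2 pays $1$ at each drawdown time occurring by $T$, $$V_2(T)=\sum_{k=1}^\infty\mathbb{E}^{\mathbb{Q}}[e^{-r\tau^k}1_{\{\tau^k\le T\}}],\qquad \tilde V_2(T)=\sum_{k=1}^\infty\mathbb{E}^{\mathbb{Q}}[e^{-r\tilde\tau^k}1_{\{\tilde\tau^k\le T\}}].$$ *)

(* Defs.v *)
From HB Require Import structures.
From mathcomp Require Import all_boot all_order all_algebra.
From mathcomp Require Import all_classical all_reals all_analysis.

Set Implicit Arguments.
Unset Strict Implicit.
Unset Printing Implicit Defensive.

Import Order.TTheory GRing.Theory Num.Theory.
Import numFieldNormedType.Exports.

Local Open Scope classical_set_scope.
Local Open Scope ring_scope.

(* Choosing [A i = setT] for some of the indices gives the product rule for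
   every subfamily. *)
Definition independent_RVs (R : realType) (d : measure_display)
    (Om : measurableType d) (P : probability Om R) (n : nat)
    (Y : 'I_n -> Om -> R) : Prop :=
  forall A : 'I_n -> set R, (forall i, measurable (A i)) ->
  P (\bigcap_(i in [set: 'I_n]) (Y i @^-1` A i)) =
  (\prod_(i < n) P (Y i @^-1` A i))%E.

(* The time index is the whole of [R], but nothing is assumed about, and
   nothing below depends on, the values at negative times. The second parameter
   of [normal_prob] is the standard deviation. The laws are compared on
   measurable sets only: a [probability] has no meaning on the other ones. *)
Record standard_brownian_motion (R : realType) (d : measure_display)
    (Om : measurableType d) (P : probability Om R)
    (W : R -> {RV P >-> R}) : Prop := {
  bm_start : {ae P, forall w, W 0 w = 0} ;
  bm_normal : forall s t : R, 0 <= s -> s < t ->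
    forall A : set R, measurable A ->
    P ((fun w => W t w - W s w) @^-1` A) =
    normal_prob 0 (Num.sqrt (t - s)) A ;
  bm_indep : forall t : nat -> R, 0 <= t 0%N -> nondecreasing_seq t ->
    forall n : nat,
    independent_RVs P (fun (i : 'I_n) w => W (t i.+1) w - W (t i) w) ;
  bm_continuous :
    {ae P, forall w, {within `[0, +oo[, continuous (fun t => W t w)}}
}.

Definition log_price (R : realType) (Om : Type) (r sigma : R)
    (W : R -> Om -> R) (t : R) (w : Om) : R :=
  (r - 2^-1 * sigma ^+ 2) * t + sigma * W t w.

Definition runmax (R : realType) (x : R -> R) (s t : R) : R :=
  sup [set x u | u in `[s, t]].

(* The price S = s0 e^x has a relative drawdown of size alpha exactly when the
   log-price x has a drawdown of size - ln (1 - alpha); this is why the drawdown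
   times below only mention x. *)
Lemma relative_drawdownE (R : realType) (x : R -> R) (s0 alpha s t : R) :
  0 < s0 -> alpha < 1 -> s <= t -> {within `[s, t], continuous x} ->
  let S := fun u => s0 * expR (x u) in
  (alpha * runmax S s t <= runmax S s t - S t) =
  (- ln (1 - alpha) <= runmax x s t - x t).
Proof.
move=> s0_gt0 alpha_lt1 st cx S.
have [c cst cmax] := EVT_max st cx.
have runmaxE (f : R -> R) : (forall u, u \in `[s, t]%R -> f u <= f c) ->
    runmax f s t = f c.
  move=> fmax; apply/eqP; rewrite eq_le; apply/andP; split.
    by apply: ge_sup; [exists (f c), c|move=> _ [u ust <-]; exact: fmax].
  by apply: ub_le_sup; [exists (f c) => _ [u ust <-]; exact: fmax|exists c].
rewrite (runmaxE x)// (runmaxE S); last first.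
  by move=> u ust; rewrite /S ler_pM2l// ler_expR cmax.
have a1 : 0 < 1 - alpha by rewrite subr_gt0.
have -> : (alpha * S c <= S c - S t) = (S t <= (1 - alpha) * S c).
  by rewrite mulrBl mul1r lerBrDr addrC -lerBrDr.
have -> : (- ln (1 - alpha) <= x c - x t) = (x t <= ln (1 - alpha) + x c).
  by rewrite lerBrDr addrC lerBlDl.
by rewrite /S mulrCA ler_pM2l// -[1 - alpha in LHS]lnK ?posrE// -expRD ler_expR.
Qed.

(* Times of the successive drawdowns of size [a] of the path [x]; the infimum in
   [\bar R] of the empty set is [+oo], and only the branch [s%:E] and the branch
   [+oo] are ever reached. *)
Fixpoint drawdown_time (R : realType) (a : R) (x : R -> R) (n : nat) : \bar R :=
  if n is m.+1 then
    if drawdown_time a x m is s%:E then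
      ereal_inf [set t%:E | t in [set t | s < t /\ a <= runmax x s t - x t]]
    else +oo%E
  else 0%E.

Fixpoint recovery_drawdown_time (R : realType) (a : R) (x : R -> R) (n : nat) :
    \bar R :=
  if n is m.+1 then
    if recovery_drawdown_time a x m is s%:E then
      ereal_inf [set t%:E | t in [set t | [/\ s < t,
        a <= runmax x 0 t - x t & runmax x 0 s < runmax x 0 t]]]
    else +oo%E
  else 0%E.

Section contracts.
Variables (R : realType) (d : measure_display) (Om : measurableType d).
Variables (Q : probability Om R) (r : R).
(* [tau n w] is the time of the n-th insured event in the state [w]. *)
Variable tau : nat -> Om -> \bar R.

Definition event_count (T : R) (w : Om) : \bar R :=
  (\sum_(1 <= n <oo) (\1_[set w' | (tau n w' <= T%:E)%E] w)%:E)%E.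

Definition price_type1 (T : R) : \bar R :=
  ((expR (- r * T))%:E * \int[Q]_w event_count T w)%E.

(* The indicator vanishes where [tau k] is infinite, so [fine] is harmless. *)
Definition price_type2 (T : R) : \bar R :=
  (\sum_(1 <= k <oo) 'E_Q[(fun w => expR (- r * fine (tau k w)) *
      \1_[set w' | (tau k w' <= T%:E)%E] w)%R])%E.

End contracts.

Definition V1 (R : realType) (d : measure_display) (Om : measurableType d)
    (Q : probability Om R) (r a : R) (X : R -> Om -> R) : R -> \bar R :=
  price_type1 Q r (fun n w => drawdown_time a (fun t => X t w) n).

Definition V1_recovery (R : realType) (d : measure_display)
    (Om : measurableType d) (Q : probability Om R) (r a : R)
    (X : R -> Om -> R) : R -> \bar R :=
  price_type1 Q r (fun n w => recovery_drawdown_time a (fun t => X t w) n).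

Definition V2 (R : realType) (d : measure_display) (Om : measurableType d)
    (Q : probability Om R) (r a : R) (X : R -> Om -> R) : R -> \bar R :=
  price_type2 Q r (fun n w => drawdown_time a (fun t => X t w) n).

Definition V2_recovery (R : realType) (d : measure_display)
    (Om : measurableType d) (Q : probability Om R) (r a : R)
    (X : R -> Om -> R) : R -> \bar R :=
  price_type2 Q r (fun n w => recovery_drawdown_time a (fun t => X t w) n).

Definition laplace (R : realType) (f : R -> \bar R) (lambda : R) : \bar R :=
  (\int[lebesgue_measure]_(T in `[0%R, +oo[) ((expR (- lambda * T))%:E * f T))%E.

Section constants.
Variables (R : realType) (r sigma : R).

Definition betap (q : R) : R :=
  (- r + 2^-1 * sigma ^+ 2 +
   Num.sqrt ((r - 2^-1 * sigma ^+ 2) ^+ 2 + 2 * q * sigma ^+ 2)) / sigma ^+ 2.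

Definition betam (q : R) : R :=
  (- r + 2^-1 * sigma ^+ 2 -
   Num.sqrt ((r - 2^-1 * sigma ^+ 2) ^+ 2 + 2 * q * sigma ^+ 2)) / sigma ^+ 2.

Definition bbar (a q : R) : R :=
  (betap q * expR (- betam q * a) - betam q * expR (- betap q * a)) /
  (expR (- betam q * a) - expR (- betap q * a)).

Definition cbar (a q : R) : R :=
  (betap q - betam q) / (expR (- betam q * a) - expR (- betap q * a)).

End constants.

(* Main.v *)
Require Import Defs.
From HB Require Import structures.
From mathcomp Require Import all_boot all_order all_algebra.
From mathcomp Require Import all_classical all_reals all_analysis.
From mathcomp Require Import measurable_realfun.
From mathcomp Require Import zify ring lra.

(* The paths are discretised on the meshes [h = 1 / (n + 1)], which avoids both
   the strong Markov property in continuous time and stochastic calculus. Let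
   [pot y = - bm e^(- bp y) + bp e^(- bm y)], where [bp > 0 > bm] are the roots
   [b] of [E e^(b (X_(t+h) - X_t)) = e^(q h)]. Discounted at rate [q], [pot] of
   the current drawdown is a martingale along the random walk [X_(k h)] except
   for the reflection at the running maximum and for the overshoots, and so is
   [e^(- bp y)] for the distance [y] to the previous maximum during a recovery.
   Since [pot] is minimal at [0] and increasing on the positive axis, these
   defects all have the same sign, so the discounted potential is a
   supermartingale; translating [pot] by [kap > 0] and discarding the
   increments larger than [kap], which are rare enough to be absorbed by a
   slightly smaller discount rate, gives a submartingale. Both bound the
   transform of the n-th drawdown time of the walk. By monotonicity in the
   drawdown size and in the recovery margin [del], the drawdown times of a
   continuous path are squeezed between those of its skeletons for perturbed
   parameters. In the limit, [E e^(- q tau^n)] is [(rho * xi) ^ (n - 1) * xi]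
   with [xi = pot 0 / pot a = c / b], where [rho] is [1] without recovery and
   [e^(- bp a)] with recovery. Tonelli's theorem and a geometric series
   conclude. *)

Set Implicit Arguments.
Unset Strict Implicit.
Unset Printing Implicit Defensive.

Import Order.TTheory GRing.Theory Num.Theory.
Import numFieldNormedType.Exports.

Local Open Scope classical_set_scope.
Local Open Scope ring_scope.

(** * The random walk and its drawdowns *)

(** Measurability of the drawdown times is never proved directly. Fatou's lemma is applied to
    functionals of the skeletons only; the discount factor at an event time and its complement to 1
    are both dominated, off a null set, by measurable functions, and as the two bounds leave no gap
    the factor agrees almost surely with a measurable one. The two comparisons are not symmetric. A
    skeleton sees only part of the path, so its drawdowns of size [a] are genuine; to miss none, the
    size must be reduced. In a recovery the old maximum may be underestimated on the grid, so the
    margin [del] is positive on one side and negative on the other. The two martingale bounds differ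
    as well: the upper one needs only the sign of the remaining value, the lower one needs that it
    vanishes, hence a bound on the potential that is uniform in time. All events are treated at once
    by weighting the potential with a power of the renewal factor that depends on the number of past
    events, so the walk is never restarted at a random time. *)

Section skeleton_chain.
Variables (R : realType) (rec : bool) (a del : R).

(* [level] is the maximum of the path up to its last event and [peak] its
   maximum since then. *)
Record state := State { nevents : nat; level : R; peak : R; pos : R }.

Definition event (s : state) (x : R) : bool :=
  (a <= Num.max (peak s) x - x) &&
  (rec ==> (level s + del < Num.max (peak s) x)).

Definition step (s : state) (d : R) : state :=
  let x := pos s + d in let m := Num.max (peak s) x in
  if event s x then State (nevents s).+1 (Num.max (level s) m) x x
  else State (nevents s) (level s) m x.

Fixpoint chain (Y : nat -> R) (k : nat) : state :=
  if k is k'.+1 then step (chain Y k') (Y k') else State 0 0 0 0.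

(** The count is read before the step: this is the event number [n + 1], and it happens at grid
    index [k + 1]. Hence the exponents [k.+1] and the indices [n.+1] below. *)
Definition event_at (Y : nat -> R) (k n : nat) : bool :=
  event (chain Y k) (pos (chain Y k) + Y k) && (nevents (chain Y k) == n).

(** Reads a state back as data of the path [S]; [l] plays the role of the index of the last event, 0
    if there is none. *)
Definition tracks (S : nat -> R) (l k : nat) (s : state) : Prop :=
  [/\ (l <= k)%N /\ pos s = S k,
      forall i, (l <= i <= k)%N -> S i <= peak s,
      exists2 i, (l <= i <= k)%N & peak s = S i,
      forall j, (j <= l)%N -> S j <= level s
    & exists2 j, (j <= l)%N & level s = S j].

(** Both maxima are attained at grid indices, so the test on the state becomes the grid counterpart
    of [drawdown_after]. *)
Lemma eventP S l k s : tracks S l k s ->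
  event s (S k.+1) <-> exists2 i, (l <= i <= k.+1)%N &
    a <= S i - S k.+1 /\ (rec -> forall j, (j <= l)%N -> S j + del < S i).
Proof.
move=> [[lk posE] peak_ub [ip ip_in peakE] level_ub [jl jl_in levelE]].
rewrite /event; split.
  move=> /andP[age /implyP recP].
  have [i i_in iE] : exists2 i, (l <= i <= k.+1)%N &
      Num.max (peak s) (S k.+1) = S i.
    have [_|_] := leP (peak s) (S k.+1); first by exists k.+1 => //; lia.
    by exists ip => //; lia.
  exists i => //; rewrite -iE; split=> // /recP lt_max j jl'.
  by apply: le_lt_trans lt_max; rewrite lerD2r level_ub.
move=> [i i_in [ai reci]].
have Si : S i <= Num.max (peak s) (S k.+1).
  have [->|ik] := eqVneq i k.+1; first by rewrite le_max lexx orbT.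
  by rewrite le_max peak_ub//; lia.
apply/andP; split; first by apply: le_trans ai _; rewrite lerD2r.
by apply/implyP => /reci /(_ _ jl_in); rewrite -levelE => /lt_le_trans; apply.
Qed.

Lemma tracks0 S : S 0%N = 0 -> tracks S 0 0 (State 0 0 0 0).
Proof.
move=> S0; split => //=.
- by move=> i; rewrite leqn0 => /eqP ->; rewrite S0.
- by exists 0%N.
- by move=> i; rewrite leqn0 => /eqP ->; rewrite S0.
- by exists 0%N.
Qed.

Lemma tracks_step S l k s : tracks S l k s ->
  let s' := step s (S k.+1 - S k) in
  if event s (S k.+1) then nevents s' = (nevents s).+1 /\ tracks S k.+1 k.+1 s'
  else nevents s' = nevents s /\ tracks S l k.+1 s'.
Proof.
move=> tr; have [[lk posE] peak_ub [ip ip_in peakE] level_ub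
  [jl jl_in levelE]] := tr.
rewrite /= /step posE addrC subrK.
have max_ub i : (l <= i <= k.+1)%N -> S i <= Num.max (peak s) (S k.+1).
  move=> li; have [->|ik] := eqVneq i k.+1; first by rewrite le_max lexx orbT.
  by rewrite le_max peak_ub//; lia.
have [i iin iE] : exists2 i, (l <= i <= k.+1)%N &
    Num.max (peak s) (S k.+1) = S i.
  have [_|_] := leP (peak s) (S k.+1); first by exists k.+1 => //; lia.
  by exists ip => //; lia.
case ev: (event s (S k.+1)); split => //=.
- split => //=.
  + by move=> j jk; rewrite (_ : j = k.+1)//; lia.
  + by exists k.+1 => //; rewrite leqnn.
  + move=> j jk; rewrite le_max; apply/orP.
    have [jl'|lj] := leqP j l; first by left; exact: level_ub.
    by right; apply: max_ub; lia.
  + have [_|_] := leP (level s) (Num.max (peak s) (S k.+1)).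
      by exists i => //; lia.
    by exists jl => //; lia.
- split => //=; first by split => //; lia.
  + by exists i.
  + by exists jl.
Qed.

Lemma chain_tracks (S : nat -> R) (k : nat) : S 0%N = 0 ->
  exists l, tracks S l k (chain (fun i => S i.+1 - S i) k).
Proof.
move=> S0; elim: k => [|k [l IH]]; first by exists 0%N; exact: tracks0.
have /= := tracks_step IH.
by case: ifP => _ [_ tr]; [exists k.+1|exists l].
Qed.

Lemma chain_nevents_le Y i j : (i <= j)%N ->
  (nevents (chain Y i) <= nevents (chain Y j))%N.
Proof.
move=> /subnK <-; elim: (j - i)%N => [//|k IH].
apply: leq_trans IH _; rewrite addSn /= /step.
by case: ifP => _ /=; lia.
Qed.

(** The count starts at 0 and grows by at most one per step, so it skips no value. *)
Lemma event_at_ex Y k n : (n < nevents (chain Y k))%N ->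
  exists2 j, (j < k)%N & event_at Y j n.
Proof.
elim: k => [//|k IH] nk.
have [/IH [j jk ev]|kn] := ltnP n (nevents (chain Y k)).
  by exists j => //; lia.
exists k => //; rewrite /event_at; move: nk; rewrite /= {1}/step.
by case: ifP => [_ /=|_ /=]; lia.
Qed.

Lemma event_at_nevents Y k n : event_at Y k n -> nevents (chain Y k.+1) = n.+1.
Proof. by rewrite /event_at /= /step => /andP[-> /eqP <-]. Qed.

Lemma event_at_uniq Y n i j : event_at Y i n -> event_at Y j n -> i = j.
Proof.
have lt_absurd k l : (k < l)%N -> event_at Y k n -> event_at Y l n -> False.
  move=> kl /event_at_nevents ck /andP[_ /eqP cl].
  by have := chain_nevents_le Y kl; rewrite ck cl; lia.
move=> ei ej; have [ij|ji|//] := ltngtP i j.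
- by case: (lt_absurd _ _ ij ei ej).
- by case: (lt_absurd _ _ ji ej ei).
Qed.

Lemma tracks_const S l k m : let Y i := S i.+1 - S i in
  tracks S l k (chain Y k) -> (k <= m)%N ->
  nevents (chain Y m) = nevents (chain Y k) -> tracks S l m (chain Y m).
Proof.
move=> Y tr /subnK <-; elim: (m - k)%N => [//|j IH].
rewrite addSn => cj.
have c_eq : nevents (chain Y (j + k)) = nevents (chain Y k).
  apply/eqP; rewrite eqn_leq -{1}cj !chain_nevents_le//; lia.
have /= := tracks_step (IH c_eq).
move: cj; rewrite /= -/(Y _) => cj.
by case: ifP => _ [cs //]; move: cs; rewrite cj c_eq; lia.
Qed.

End skeleton_chain.

(** * Comparison of a path with its skeletons *)

Lemma ler_sub_near (R : realType) (a a' w p q p' q' : R) :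
  a' + 2 * w <= a -> a <= p - q -> `|p - p'| < w -> `|q - q'| < w ->
  a' <= p' - q'.
Proof. by rewrite !ltr_norml => ? ? /andP[? ?] /andP[? ?]; lra. Qed.

Lemma ltr_sub_near (R : realType) (p p' q w del : R) :
  q < p + w -> `|p - p'| < w -> 2 * w <= del -> q - del < p'.
Proof. by rewrite ltr_norml => ? /andP[? ?] ?; lra. Qed.

Section event_times.
Variables (R : realType) (rec : bool).
Implicit Types (x : R -> R) (a s t h e T : R).

(* The running maximum is attained at some [u]; quantifying over [u] gives one
   definition for the drawdowns with and without recovery. *)
Definition drawdown_after a x s t : Prop :=
  exists2 u, s <= u <= t &
    a <= x u - x t /\ (rec -> forall v, 0 <= v <= s -> x v < x u).

Fixpoint event_time a x (n : nat) : \bar R :=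
  if n is m.+1 then
    if event_time a x m is s%:E then
      ereal_inf [set t%:E | t in drawdown_after a x s]
    else +oo%E
  else 0%E.

Lemma drawdown_after_lt a x s t : 0 < a -> drawdown_after a x s t -> s < t.
Proof.
move=> a0 [u /andP[su ut] [aut _]]; have := le_trans su ut.
rewrite le_eqVlt => /predU1P[st|//]; move: aut.
have -> : u = t by apply/le_anti; rewrite ut -st su.
by rewrite subrr leNgt a0.
Qed.

Lemma event_time_ge0 a x n : 0 < a -> (0 <= event_time a x n)%E.
Proof.
move=> a0; elim: n => [//|n /=]; case: (event_time a x n) => [s|_|_] //= s0.
apply: le_ereal_inf_tmp => _ [t /(drawdown_after_lt a0) st <-].
by rewrite lee_fin (le_trans _ (ltW st)).
Qed.

Definition osc_lt x T h e : Prop := forall u v,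
  0 <= u <= T -> 0 <= v <= T -> `|u - v| <= h -> `|x u - x v| < e.

Section skeleton.
Variables (x : R -> R) (h : R).
Hypotheses (x0 : x 0 = 0) (h0 : 0 < h).

Definition skeleton (k : nat) : R := x (k%:R * h).

Local Notation S := skeleton.

Definition increments (k : nat) : R := x (k.+1%:R * h) - x (k%:R * h).

Let S0 : S 0%N = 0. Proof. by rewrite /skeleton mul0r. Qed.

Let grid_le i j : (i%:R * h <= j%:R * h) = (i <= j)%N.
Proof. by rewrite ler_pM2r// ler_nat. Qed.

(** Drawdowns on the grid are drawdowns of the path, so the path can only be earlier. In a recovery
    the old maximum of the path may exceed the one seen on the grid, but by less than [del]. *)
Lemma event_time_le_skeleton a del T k n : 0 < a -> 0 <= T ->
  osc_lt x T h del -> k.+1%:R * h <= T -> event_at rec a del increments k n ->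
  (event_time a x n.+1 <= (k.+1%:R * h)%:E)%E.
Proof.
move=> a0 T0 osc kT evk.
(* The bound is strengthened to the index [l] of the last event of the walk: the next event of the
   path may then use every grid point from [l] on. *)
have inv j : (j <= k.+1)%N -> exists l, tracks S l j (chain rec a del
  increments j)
    /\ (event_time a x (nevents (chain rec a del increments j)) <= (l%:R *
      h)%:E)%E.
  elim: j => [|j IH] jk.
    by exists 0%N; split; [exact: tracks0|rewrite mul0r].
  have [l [tr time_le]] := IH (ltnW jk).
  have := tracks_step rec a del tr; rewrite /=.
  case ev: (event _ _ _ _ _) => -[cE tr'].
    exists j.+1; split => //.
    rewrite [chain _ _ _ _ _]/= cE /=.
    have := event_time_ge0 x (nevents (chain rec a del increments j)) a0.
    case: (event_time _ _ _) time_le => [s||]; rewrite ?lee_fin//.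
    move=> sl s0; apply: ereal_inf_lbound.
    have /(eventP rec a del tr) [i /andP[li ij] [ai reci]] := ev.
    exists (j.+1%:R * h) => //; exists (i%:R * h).
      by rewrite (le_trans sl) grid_le.
    split => // rec1 v /andP[v0 vs].
    (* The last grid point not after [v]; it does not exceed [l], so the margin test of the walk
       applies to it. *)
    pose m := Num.trunc (v / h).
    have vh0 : 0 <= v / h by rewrite divr_ge0// ltW.
    have /andP[mv vm] := truncn_itv vh0.
    rewrite -/m in mv vm.
    have {}mv : m%:R * h <= v by rewrite -ler_pdivlMr.
    have {}vm : v < m.+1%:R * h by rewrite -ltr_pdivrMr.
    have ml : (m <= l)%N by rewrite -grid_le (le_trans mv)// (le_trans vs).
    apply: lt_trans (reci rec1 m ml).
    have lT : l%:R * h <= T.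
      have [[lj _] _ _ _ _] := tr.
      by apply: le_trans kT; rewrite grid_le (leq_trans lj)// ltnW.
    have vT : v <= T by rewrite (le_trans vs)// (le_trans sl).
    have : `|x v - S m| < del.
      apply: osc; first by rewrite v0.
        by rewrite mulr_ge0 ?ler0n ?(ltW h0)// (le_trans mv).
      rewrite ger0_norm ?subr_ge0//.
      by move: vm; rewrite -natr1 mulrDl mul1r; lra.
    by rewrite ltr_norml => /andP[_]; rewrite ltrBlDl.
  exists l; split => //.
  by rewrite [chain _ _ _ _ _]/= cE.
have [l [tr time_le]] := inv k.+1 (leqnn _).
move: time_le; rewrite (event_at_nevents evk) => /le_trans; apply.
by rewrite lee_fin grid_le; have [[]] := tr.
Qed.


Definition grid_above (t : R) : nat := (Num.trunc (t / h)).+1.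

Local Notation above := grid_above.

Let aboveP t : 0 <= t -> t < (above t)%:R * h <= t + h.
Proof.
move=> t0; have th0 : 0 <= t / h by rewrite divr_ge0// ltW.
have /andP[mt tm] := truncn_itv th0; rewrite /grid_above.
rewrite -ltr_pdivrMr// tm /= -natr1 mulrDl mul1r lerD2r.
by rewrite -ler_pdivlMr.
Qed.

Let above_le s t : 0 <= s -> s <= t -> (above s <= above t)%N.
Proof.
by move=> s0 st; rewrite /grid_above ltnS le_truncn// ler_pM2r// invr_gt0.
Qed.

Let above_eq s t : 0 <= s -> s <= t -> t < (above s)%:R * h ->
  above t = above s.
Proof.
move=> s0 st ts; apply/eqP; rewrite eqn_leq; apply/andP; split;
  last exact: above_le.
rewrite -[leqLHS]/(Num.trunc (t / h)).+1 -(ltr_nat R).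
apply: le_lt_trans (_ : t / h < _).
  by have /andP[] := truncn_itv (divr_ge0 (le_trans s0 st) (ltW h0)).
by rewrite ltr_pdivrMr.
Qed.

Section skeleton_le.
Variables (a a' del w T : R).
Hypotheses (a0 : 0 < a) (a'0 : 0 < a') (aa' : a' + 2 * w <= a).
Hypotheses (wdel : 2 * w <= del) (w0 : 0 <= w) (osc : osc_lt x T h w).

Let Y := chain rec a' (- del) increments.

Let near u : 0 <= u -> u + h <= T -> `|x u - S (above u)| < w.
Proof.
move=> u0 uT; have /andP[lu ul] := aboveP u0.
apply: osc; first by rewrite u0 (le_trans _ uT)// lerDl ltW.
  by rewrite (le_trans ul uT) (le_trans u0 (ltW lu)).
by rewrite distrC ger0_norm ?subr_ge0 ?(ltW lu)// lerBlDl.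
Qed.

(** Induction on the events. If the walk registered nothing between the grid points that follow two
    successive event times, it would still be in the same phase, and the drop of the path, visible
    on the grid up to [2 * w], would trigger an event. *)
Lemma nevents_ge n t : event_time a x n = t%:E -> t + 2 * h <= T ->
  (n <= nevents (Y (above t)))%N.
Proof.
elim: n t => [//|n IH] t /=.
have := event_time_ge0 x n a0.
case: (event_time a x n) IH => [s|_ _ //|_ _ //] IH;
  rewrite lee_fin => s0 inf_t tT.
have inf_lb t' : drawdown_after a x s t' -> t <= t'.
  by move=> dd; rewrite -lee_fin -inf_t; apply: ereal_inf_lbound; exists t'.
have st : s <= t.
  rewrite -lee_fin -inf_t; apply: le_ereal_inf_tmp => _ [t' dd <-].
  by rewrite lee_fin ltW// (drawdown_after_lt a0 dd).
have t0 := le_trans s0 st.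
(* The infimum is not known to be attained; a time [t'] of the set in the same mesh cell has the
   same [grid_above]. *)
have [t' dd t't] : exists2 t', drawdown_after a x s t' &
    t' < (above t)%:R * h.
  have : (ereal_inf [set t%:E | t in drawdown_after a x s] <
      ((above t)%:R * h)%:E)%E.
    by rewrite inf_t lte_fin; have /andP[] := aboveP t0.
  by case/ereal_inf_lt => _ [t' dd <-]; rewrite lte_fin; exists t'.
have tt' := inf_lb _ dd.
rewrite -(above_eq t0 tt' t't).
have aboveK s' : 0 <= s' -> s' <= t' -> (above s' <= above t')%N.
  exact: above_le.
have nt' := near (le_trans t0 tt').
move: (above t') aboveK nt' => K aboveK nt'.
have sn : (n <= nevents (Y (above s)))%N.
  by apply: IH => //; rewrite (le_trans _ tT)// lerD2r.
have sK : (above s <= K)%N by rewrite aboveK// (le_trans st).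
rewrite ltnNge; apply/negP => Kn.
have cst j : (above s <= j <= K)%N -> nevents (Y j) = nevents (Y (above s)).
  move=> /andP[sj jK]; apply/eqP; rewrite eqn_leq.
  apply/andP; split; last exact: chain_nevents_le.
  by apply: leq_trans (leq_trans Kn sn); exact: chain_nevents_le.
case: dd => u /andP[su ut'] [aut rcu].
have u0 := le_trans s0 su.
have t'T : t' + h <= T.
  have /andP[_ le_th] := aboveP t0; apply: le_trans tT.
  by have := lt_le_trans t't le_th; lra.
have uT : u + h <= T by rewrite (le_trans _ t'T)// lerD2r.
have [l tr] := chain_tracks rec a' (- del) (above s) S0.
have [[ls _] _ _ _ _] := tr.
have above_u : (above s <= above u <= K)%N by rewrite above_le// aboveK.
have nu := near u0 uT; have {}nt' := nt' t'T.
have drop : a' <= S (above u) - S K.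
  exact: ler_sub_near aa' aut nu nt'.
(* Otherwise the drop would be between a grid point and itself. *)
have sK1 : (above s < K)%N.
  rewrite ltn_neqAle sK andbT; apply/eqP => sKE.
  have uK : above u = K by apply/eqP; rewrite eqn_leq -{2}sKE andbC.
  by move: drop; rewrite uK subrr leNgt a'0.
case: K sK cst aboveK above_u nt' drop sK1 Kn => // K sK cst _ above_u nt' drop
  sK1 Kn.
have trK : tracks S l K (Y K).
  by apply: (tracks_const tr) => //; apply: cst; rewrite leqnSn andbT.
have := tracks_step rec a' (- del) trK.
have -> : event rec a' (- del) (Y K) (S K.+1) = true.
  apply/(eventP rec a' (- del) trK); exists (above u).
    by have /andP[su' ->] := above_u; rewrite (leq_trans ls).
  split=> // rec1 j jl.
  (* A grid point up to [l] may still lie after [s], by at most [h]; it is then compared with [x s],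
     which is below [x u]. *)
  have lub : S j < x u + w.
    have [js|sj] := leP (j%:R * h) s.
      by have := rcu rec1 (j%:R * h); rewrite js mulr_ge0 ?ler0n ?(ltW h0)//
        => /(_ erefl) /lt_le_trans; apply; rewrite lerDl.
    have /andP[_ abs_s] := aboveP s0.
    have jsh : j%:R * h <= s + h.
      by apply: le_trans abs_s; rewrite grid_le (leq_trans jl).
    have : `|S j - x s| < w.
      apply: osc.
      - by rewrite (le_trans s0 (ltW sj))/= (le_trans jsh)// (le_trans _ uT)//
          lerD2r.
      - by rewrite s0 (le_trans _ uT)// (le_trans su)// lerDl ltW.
      - by rewrite ger0_norm ?subr_ge0 ?(ltW sj)// lerBlDl.
    have := rcu rec1 s; rewrite s0 lexx => /(_ erefl).
    move=> xsu /ltr_normlW; rewrite ltrBlDl => /lt_trans; apply.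
    by rewrite ltrD2r.
  exact: ltr_sub_near lub nu wdel.
rewrite -[step _ _ _ _ _]/(Y K.+1) => -[].
by rewrite !cst ?leqnSn ?sK ?leqnn ?andbT// => /n_Sn.
Qed.

Lemma skeleton_le_event_time n t : event_time a x n.+1 = t%:E ->
  t + 2 * h <= T ->
  exists2 k, event_at rec a' (- del) increments k n & k.+1%:R * h <= t + h.
Proof.
move=> tE tT; have [k ka evk] := event_at_ex (nevents_ge tE tT).
exists k => //; have t0 : 0 <= t by rewrite -lee_fin -tE event_time_ge0.
by have /andP[_] := aboveP t0; apply: le_trans; rewrite grid_le.
Qed.

End skeleton_le.

End skeleton.
End event_times.

Section continuous_paths.
Variables (R : realType) (x : R -> R).
Hypothesis cx : {within `[0, +oo[, continuous x}.

(** Uniform continuity on a segment, from the covering form of compactness. *)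
Lemma osc_lt_near (T e : R) : 0 < e ->
  \forall i \near \oo, osc_lt x T i.+1%:R^-1 e.
Proof.
move=> e0; have e20 : 0 < e / 2 by rewrite divr_gt0.
have /compact_near_coveringP/near_covering_withinP cov := @segment_compact R 0
  T.
have := cov nat \oo (fun i u => forall v, 0 <= v <= T ->
  `|u - v| <= i.+1%:R^-1 -> `|x u - x v| < e) _ _.
case=> [u /=|N _ osc]; last first.
  exists N => // i Ni u v uT vT uv; apply: (osc i Ni u) => //=.
rewrite in_itv /= => /andP[u0 uT].
have xu : x v @[v --> within `[0, +oo[ (nbhs u)] --> x u.
  by move/subspace_continuousP : cx; apply; rewrite /= in_itv /= u0.
move/cvgrPdist_lt : xu => /(_ _ e20); rewrite near_withinE near_simpl.
move=> /nbhs_ballP[d /= d0 near_u].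
have d20 : 0 < d / 2 by rewrite divr_gt0.
have close v : 0 <= v -> `|u - v| < d -> `|x u - x v| < e / 2.
  by move=> v0 uv; apply: near_u => //=; rewrite in_itv /= v0.
near=> u' i => /=; rewrite in_itv /= => /andP[u'0 u'T] v /andP[v0 vT] u'v.
have uu' : `|u - u'| < d / 2.
  by near: u'; apply/nbhs_ballP; exists (d / 2).
have id : i.+1%:R^-1 < d / 2 by near: i;
  exact: near_infty_natSinv_lt (PosNum d20).
rewrite (splitr e) (le_lt_trans (ler_distD (x u) _ _))// ltrD//.
  by rewrite distrC close// (lt_trans uu')// ltr_pdivrMr// mulr2n mulrDr mulr1
    ltrDl.
rewrite close// [d]splitr (le_lt_trans (ler_distD u' _ _))// ltrD//.
exact: le_lt_trans id.
Unshelve. all: by end_near. Qed.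

Lemma runmax_attained (s t : R) : 0 <= s -> s <= t ->
  exists2 c, s <= c <= t & runmax x s t = x c /\
    forall u, s <= u <= t -> x u <= x c.
Proof.
move=> s0 st.
have cst : {within `[s, t], continuous x}.
  apply: continuous_subspaceW cx => u /=; rewrite !in_itv /= andbT.
  by move=> /andP[su _]; exact: le_trans su.
have [c] := EVT_max st cst; rewrite in_itv /= => cin cmax.
exists c => //; split; last by move=> u uin; apply: cmax; rewrite in_itv.
apply/eqP; rewrite eq_le; apply/andP; split.
  apply: ge_sup; first by exists (x c), c => //=; rewrite in_itv.
  by move=> _ [u ust <-]; exact: cmax.
apply: ub_le_sup; last by exists c => //=; rewrite in_itv.
by exists (x c) => _ [u ust <-]; exact: cmax.
Qed.

Lemma drawdown_timeE (a : R) n : 0 < a ->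
  drawdown_time a x n = event_time false a x n.
Proof.
move=> a0; elim: n => [//|n /= ->].
have := event_time_ge0 false x n a0.
case: (event_time false a x n) => [s|//|//]; rewrite lee_fin => s0.
congr ereal_inf; apply/seteqP; split=> _ [t dd <-]; exists t => //.
  case: dd => st; have [c cin [-> _]] := runmax_attained s0 (ltW st).
  by exists c.
split; first exact: drawdown_after_lt dd.
have [u uin [aut _]] := dd; case/andP: (uin) => su ut.
have [c cin [-> cmax]] := runmax_attained s0 (le_trans su ut).
by rewrite (le_trans aut)// lerD2r cmax.
Qed.

(** A maximum over [[0, t]] that exceeds the maximum over [[0, s]] is attained after [s], so the two
    ways of measuring the drop agree. *)
Lemma recovery_drawdown_timeE (a : R) n : 0 < a ->
  recovery_drawdown_time a x n = event_time true a x n.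
Proof.
move=> a0; elim: n => [//|n /= ->].
have := event_time_ge0 true x n a0.
case: (event_time true a x n) => [s|//|//]; rewrite lee_fin => s0.
have [cs /andP[cs0 css] [rs csmax]] := runmax_attained (lexx 0) s0.
congr ereal_inf; apply/seteqP; split=> _ [t dd <-]; exists t => //.
  case: dd => st.
  have [c /andP[c0 ct] [-> _]] := runmax_attained (lexx 0) (le_trans s0 (ltW
    st)).
  rewrite rs => drop rec; exists c.
    by rewrite ct andbT leNgt; apply/negP => cs'; move: rec;
      rewrite ltNge csmax// c0 ltW.
  split=> // _ v vin; apply: le_lt_trans rec; exact: csmax.
have st := drawdown_after_lt a0 dd; have [u /andP[su ut] [aut rcu]] := dd.
have [c _ [rt cmax]] := runmax_attained (lexx 0) (le_trans s0 (ltW st)).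
have uc : x u <= x c by rewrite cmax// ut (le_trans s0).
split; rewrite // ?rs rt; first by rewrite (le_trans aut)// lerD2r.
by apply: lt_le_trans uc; apply: rcu; rewrite ?cs0.
Qed.

End continuous_paths.

(** * One-step inequalities for the potential *)

Section potential.
Variables (R : realType) (bp bm : R).
Hypotheses (bp0 : 0 < bp) (bm0 : bm < 0).

(** Among the combinations of the two exponentials, the one (up to a factor) whose derivative
    vanishes at 0, as reflection at the running maximum demands. *)
Definition pot (y : R) : R := - bm * expR (- bp * y) + bp * expR (- bm * y).

Lemma pot0 : pot 0 = bp - bm.
Proof. by rewrite /pot !mulr0 expR0; ring. Qed.

Lemma pot_gt0 y : 0 < pot y.
Proof. by rewrite addr_gt0// mulr_gt0 ?expR_gt0// oppr_gt0. Qed.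

Lemma pot_min y : pot 0 <= pot y.
Proof.
rewrite pot0 /pot.
apply: le_trans (_ : - bm * (1 + - bp * y) + bp * (1 + - bm * y) <= _).
  by rewrite le_eqVlt; apply/orP; left; apply/eqP; ring.
by rewrite lerD// ler_pM2l ?oppr_gt0// expR_ge1Dx.
Qed.

Lemma pot_nondecreasing y z : 0 <= y -> y <= z -> pot y <= pot z.
Proof.
move: bp0 bm0 => bp_gt0 bm_lt0; move=> y0 yz; rewrite -[z](subrK y);
  move: (z - y) (subr_ge0 y z) => t.
rewrite yz => t0; rewrite /pot !mulrDr !expRD.
have e1 := expR_ge1Dx (- bp * t); have e2 := expR_ge1Dx (- bm * t).
have ep := expR_gt0 (- bp * y); have em := expR_gt0 (- bm * y).
have epm : expR (- bp * y) <= expR (- bm * y).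
  by rewrite ler_expR ler_wpM2r//; lra.
rewrite -subr_ge0.
(* Expansion at [y]: two convexity remainders plus [t] times the derivative of [pot] at [y], all
   nonnegative. *)
have -> : - bm * (expR (- bp * t) * expR (- bp * y)) +
    bp * (expR (- bm * t) * expR (- bm * y)) -
    (- bm * expR (- bp * y) + bp * expR (- bm * y)) =
    - bm * expR (- bp * y) * (expR (- bp * t) - (1 + - bp * t)) +
    bp * expR (- bm * y) * (expR (- bm * t) - (1 + - bm * t)) +
    bp * - bm * t * (expR (- bm * y) - expR (- bp * y)) by ring.
by rewrite !addr_ge0// !mulr_ge0 ?subr_ge0 ?oppr_ge0 ?expR_ge0 ?(ltW bp0) ?(ltW
  bm0).
Qed.

Section step.
Variables (rec : bool) (a del kap : R).
Hypotheses (a0 : 0 < a).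

Definition recovering (s : state R) : bool :=
  rec && (peak s <= level s + del).

(* The coefficients of [e^(bp d)] and of [e^(bm d)] in the value reached from
   [s] by an increment [d] that meets neither the reflection nor the end of
   the phase. *)
Definition weightp (s : state R) : R :=
  if recovering s then pot kap * expR (- bp * (kap + (level s + del - pos s)))
  else - bm * expR (- bp * (peak s - pos s + kap)).

Definition weightm (s : state R) : R :=
  if recovering s then 0 else bp * expR (- bm * (peak s - pos s + kap)).

Definition value (s : state R) : R := weightp s + weightm s.

(* The ratio of the transforms of two successive event times (for [kap = 0] and
   [del = 0]). *)
Definition renewal : R :=
  (if rec then expR (- bp * (a + 2 * kap + del)) else 1) *
  (pot kap / pot (a + 2 * kap)).

Lemma valueE s : value s =
  if recovering s then pot kap * expR (- bp * (kap + (level s + del - pos s)))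
  else pot (peak s - pos s + kap).
Proof. by rewrite /value /weightp /weightm; case: ifP; rewrite ?addr0. Qed.

Lemma weightp_ge0 s : 0 <= weightp s.
Proof.
rewrite /weightp; case: ifP => _;
  rewrite mulr_ge0 ?expR_ge0 ?(ltW (pot_gt0 _))//.
by rewrite oppr_ge0 ltW.
Qed.

Lemma weightm_ge0 s : 0 <= weightm s.
Proof. by rewrite /weightm; case: ifP => _;
  rewrite // mulr_ge0 ?expR_ge0 ?ltW. Qed.

Lemma value_ge0 s : 0 <= value s.
Proof. by rewrite addr_ge0 ?weightp_ge0 ?weightm_ge0. Qed.

Let free (s : state R) (d : R) : R :=
  weightp s * expR (bp * d) + weightm s * expR (bm * d).

Let freeE s d : free s d = if recovering s
  then pot kap * expR (- bp * (kap + (level s + del - (pos s + d))))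
  else pot (peak s - (pos s + d) + kap).
Proof.
rewrite /free /weightp /weightm /pot; case: ifP => _.
  by rewrite mul0r addr0 -mulrA -expRD; congr (_ * expR _); ring.
by rewrite -!mulrA -!expRD; congr (_ * expR _ + _ * expR _); ring.
Qed.

(** At the step that completes a recovery the new position is itself the maximum, so the drawdown is
    0 and no event can happen. *)
Lemma event_watching s d : event rec a del s d -> ~~ recovering s.
Proof.
rewrite /event /recovering => /andP[ad rd]; apply/negP => /andP[rec1 le_peak].
move: rd ad; rewrite rec1 /= lt_max ltNge le_peak /= => /(le_lt_trans le_peak).
by move=> /ltW /max_r ->; rewrite subrr leNgt a0.
Qed.

(** During a recovery the drawdown may exceed [a] without an event, hence the restriction. *)
Definition well_formed (s : state R) : Prop :=
  pos s <= peak s /\ (~~ recovering s -> peak s - pos s < a).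

Lemma step_well_formed s d : well_formed (step rec a del s d).
Proof.
rewrite /step; case: ifPn => [_|nev]; split => /=.
- by [].
- by move=> _; rewrite subrr.
- by rewrite le_max lexx orbT.
- move: nev; rewrite /event negb_and -ltNge => /orP[lt_a _ //|].
  by rewrite negb_imply -leNgt /recovering /= => /andP[-> ->].
Qed.

Lemma value_le s : 0 <= kap -> well_formed s -> value s <= pot (a + kap) + pot
  kap.
Proof.
move=> kap0 [pp wf]; rewrite valueE; case: ifPn => [/andP[_ rs]|/wf lt_a].
  rewrite -[leLHS]add0r lerD ?(ltW (pot_gt0 _))//.
  rewrite ler_piMr ?(ltW (pot_gt0 _))// -expR0 ler_expR mulNr oppr_le0.
  by rewrite mulr_ge0 ?(ltW bp0)// addr_ge0// subr_ge0 (le_trans pp).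
rewrite -[leLHS]addr0 lerD ?(ltW (pot_gt0 _))//.
by apply: pot_nondecreasing; [rewrite addr_ge0// subr_ge0|rewrite lerD2r ltW].
Qed.

(** The two defects have the same sign: jumping over the recovery threshold makes the free
    exponential at least 1, and reflection replaces a negative argument of [pot] by 0, where [pot]
    is minimal. *)
Lemma value_step_le s d : kap = 0 ->
  ~~ event rec a del s (pos s + d) -> value (step rec a del s d) <= free s d.
Proof.
move=> kap0 nev; rewrite valueE freeE /step (negbTE nev) /recovering /=.
case: (boolP (rec && (peak s <= level s + del))) => /= [/andP[rec1 ps]|].
  rewrite rec1 /= ge_max ps /=;
    case: (leP (pos s + d) (level s + del)) => // lt_x.
  rewrite max_r ?subrr ?add0r; last by rewrite ltW// (le_lt_trans ps).
  rewrite ler_peMr ?(ltW (pot_gt0 _))// -expR0 ler_expR kap0 add0r.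
  by rewrite mulNr -mulrN mulr_ge0 ?(ltW bp0)// oppr_ge0 subr_le0 ltW.
move=> nrec; rewrite (_ : _ && _ = false); last first.
  by move: nrec; case: (rec) => //=;
    rewrite -ltNge [in X in _ -> X]leNgt lt_max => ->.
rewrite kap0 !addr0; have [_|_] := leP (peak s) (pos s + d); last by [].
by rewrite subrr pot_min.
Qed.

(** Overshooting the size [a] only increases [pot]. After the event the recovery threshold is at
    distance at least [a + del], and [- a < del] ensures that the walk is then recovering. *)
Lemma value_event_le s d : kap = 0 -> - a < del ->
  event rec a del s (pos s + d) ->
  value (step rec a del s d) <= renewal * pot (a + 2 * kap) /\
  pot (a + 2 * kap) <= free s d.
Proof.
have [bp_gt0 a_gt0] := (bp0, a0).
move=> kap0 adel ev; have nrec := event_watching ev.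
rewrite valueE freeE (negbTE nrec) /step ev /recovering /=.
rewrite /renewal -mulrA divfK ?gt_eqF ?pot_gt0//.
have ap : pos s + d <= peak s - a.
  move: ev => /andP[+ _]; have [_|_] := leP (peak s) (pos s + d).
    by rewrite subrr leNgt a0.
  lra.
have mp : Num.max (peak s) (pos s + d) = peak s by apply: max_l; lra.
rewrite mp; split; last by apply: pot_nondecreasing; rewrite kap0; lra.
have pL : peak s <= Num.max (level s) (peak s) by rewrite le_max lexx orbT.
case: (rec) => /=; last by rewrite subrr add0r mul1r.
rewrite ifT; last by lra.
rewrite mulrC ler_pM2r ?pot_gt0// ler_expR kap0 ler_nM2l; lra.
Qed.

(** With increments of size at most [kap], the translation keeps the argument of [pot] in the
    positive half-line, where [pot] is nondecreasing; it also compensates the jump over the recovery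
    threshold. *)
Lemma value_step_ge s d : well_formed s -> `|d| <= kap ->
  ~~ event rec a del s (pos s + d) -> free s d <= value (step rec a del s d).
Proof.
have [bp_gt0 a_gt0] := (bp0, a0).
rewrite ler_norml => -[pp wf] /andP[kd dk] nev.
rewrite valueE freeE /step (negbTE nev) /recovering /=.
rewrite -/(recovering s); case: ifPn => [/andP[rec1 ps]|nrec].
  rewrite rec1 /= ge_max ps /=;
    case: (leP (pos s + d) (level s + del)) => // lt_x.
  rewrite max_r ?subrr ?add0r; last by rewrite ltW// (le_lt_trans ps).
  rewrite ler_piMr ?(ltW (pot_gt0 _))// -expR0 ler_expR mulNr oppr_le0.
  by rewrite mulr_ge0 ?(ltW bp0)//; lra.
rewrite (_ : _ && _ = false); last first.
  by move: nrec; rewrite /recovering; case: (rec) => //=;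
    rewrite -ltNge [in X in _ -> X]leNgt lt_max => ->.
have [le_x|_] := leP (peak s) (pos s + d); last by [].
by apply: pot_nondecreasing; lra.
Qed.

(** The drawdown was less than [a]; the increment and the translation add at most [kap] each, whence
    [a + 2 * kap]. As [0 <= del], the old peak becomes the level, so the recovery threshold is at
    distance at most [a + kap + del]; one more [kap] gives the exponent in [renewal]. *)
Lemma value_event_ge s d : well_formed s -> `|d| <= kap -> 0 <= del ->
  event rec a del s (pos s + d) ->
  renewal * pot (a + 2 * kap) <= value (step rec a del s d) /\
  free s d <= pot (a + 2 * kap).
Proof.
have [bp_gt0 a_gt0] := (bp0, a0).
rewrite ler_norml => -[pp wf] /andP[kd dk] del0 ev;
  have nrec := event_watching ev.
have lt_a := wf nrec.
rewrite valueE freeE (negbTE nrec) /step ev /recovering /=.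
rewrite /renewal -mulrA divfK ?gt_eqF ?pot_gt0//.
have ap : pos s + d <= peak s - a.
  move: ev => /andP[+ _]; have [_|_] := leP (peak s) (pos s + d).
    by rewrite subrr leNgt a0.
  lra.
have mp : Num.max (peak s) (pos s + d) = peak s by apply: max_l; lra.
rewrite mp; split; last by apply: pot_nondecreasing; lra.
move: nrec; rewrite /recovering.
case: (rec) => /=; last by rewrite subrr add0r mul1r.
rewrite -ltNge => lv; rewrite max_r; last by lra.
rewrite ifT; last by lra.
rewrite [leRHS]mulrC ler_pM2r ?pot_gt0// ler_expR ler_nM2l; lra.
Qed.

End step.
End potential.

(** * Transforms of the drawdown times of the random walk *)

Section independence.
Context d (Om : measurableType d) (R : realType) (P : probability Om R).
Local Open Scope ereal_scope.

(** The joint law and the product of the laws agree on rectangles, hence everywhere; Tonelli's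
    theorem then factors the integral. *)
Lemma ge0_integral_indep d1 (T1 : measurableType d1) d2 (T2 : measurableType d2)
    (X : {mfun Om >-> T1}) (Y : {mfun Om >-> T2})
    (f : T1 -> R) (g : T2 -> R) :
  (forall A B, measurable A -> measurable B ->
     P (X @^-1` A `&` Y @^-1` B) = P (X @^-1` A) * P (Y @^-1` B)) ->
  measurable_fun setT f -> measurable_fun setT g ->
  (forall x, 0 <= f x)%R -> (forall y, 0 <= g y)%R ->
  \int[P]_w (f (X w) * g (Y w))%:E =
  (\int[P]_w (f (X w))%:E) * (\int[P]_w (g (Y w))%:E).
Proof.
move=> indep mf mg f0 g0.
pose XY w := (X w, Y w).
have mXY : measurable_fun setT XY by exact/measurable_fun_pair.
pose m1 : {sigma_finite_measure set T1 -> \bar R} := distribution P X.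
pose m2 : {sigma_finite_measure set T2 -> \bar R} := distribution P Y.
pose XYf : {mfun Om >-> (T1 * T2)%type} :=
  HB.pack XY (isMeasurableFun.Build _ _ _ _ XY mXY).
pose m : probability (T1 * T2)%type R := distribution P XYf.
pose h (z : T1 * T2) := (f z.1 * g z.2)%:E.
have mh : measurable_fun setT h.
  by apply/measurable_EFinP/measurable_funM; apply: measurableT_comp.
have h0 z : 0 <= h z by rewrite lee_fin mulr_ge0.
transitivity (\int[m]_z h z).
  by rewrite ge0_integral_pushforward// => z _; exact: h0.
transitivity (\int[m1 \x m2]_z h z).
  apply: eq_measure_integral => A mA _; apply/esym.
  by apply: product_measure_unique => // B C mB mC; exact: indep.
rewrite fubini_tonelli1//.
transitivity (\int[m1]_x ((f x)%:E * \int[m2]_y (g y)%:E)).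
  apply: eq_integral => x _; rewrite /fubini_F /h /=.
  under eq_integral do rewrite EFinM.
  rewrite ge0_integralZl//; [exact/measurable_EFinP| |by rewrite lee_fin].
  by move=> y _; rewrite lee_fin.
rewrite ge0_integralZr//; last 3 first.
- exact/measurable_EFinP.
- by move=> x _; rewrite lee_fin.
- by apply: integral_ge0 => y _; rewrite lee_fin.
congr (_ * _).
  rewrite ge0_integral_pushforward//; first exact/measurable_EFinP.
  by move=> x _; rewrite lee_fin.
rewrite ge0_integral_pushforward//; first exact/measurable_EFinP.
by move=> x _; rewrite lee_fin.
Qed.

Variable Y : nat -> {RV P >-> R}.
Hypothesis indepY : forall n, independent_RVs P (fun i : 'I_n => Y i).

Definition cylinders (k : nat) : set (set Om) :=
  [set B | exists2 A : nat -> set R, (forall i, measurable (A i)) &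
    B = \bigcap_(i in [set i | (i < k)%N]) (Y i @^-1` A i)].

Let cylinders_measurable k : cylinders k `<=` measurable.
Proof.
move=> _ [A mA ->]; apply: bigcap_measurableType => i _.
exact: measurable_funPTI.
Qed.

(** The sigma-algebra of the first [k] variables, as a second measurable structure on [Om]: being
    determined by the past is then measurability from [past k]. *)
Definition past k := g_sigma_algebraType (cylinders k).

Let past_sub k : @measurable _ (past k) `<=` @measurable _ Om.
Proof.
apply: smallest_sub; first exact: sigma_algebra_measurable.
exact: cylinders_measurable.
Qed.

Lemma measurable_past k i : (i < k)%N ->
  measurable_fun setT (Y i : past k -> R).
Proof.
move=> ik _ A mA; rewrite setTI; apply: sub_gen_smallest.
exists (fun j => if j == i then A else setT); first by move=> j; case: ifP.
apply/seteqP; split=> [w Aw j _|w /(_ i ik)] /=; last by rewrite eqxx.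
by case: eqP => // ->.
Qed.

Lemma measurable_past_id k : measurable_fun setT (id : Om -> past k).
Proof. by move=> _ A mA; rewrite setTI; exact: (@past_sub k A mA). Qed.

Let P_cylinder k (A : nat -> set R) : (forall i, measurable (A i)) ->
  P (\bigcap_(i in [set i | (i < k)%N]) (Y i @^-1` A i)) =
  \prod_(i < k) P (Y i @^-1` A i).
Proof.
move=> mA; rewrite -(indepY (fun i : 'I_k => mA i)); congr (P _).
apply/seteqP; split=> w Aw i; first by move=> _; exact: (Aw i (ltn_ord i)).
by move=> /= ik; exact: (Aw (Ordinal ik)).
Qed.

(** Dynkin's argument: the sets satisfying the product rule contain the cylinders, which are stable
    under intersection, and are closed under complements and disjoint countable unions. *)
Lemma past_indep k A B : @measurable _ (past k) A -> measurable B ->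
  P (A `&` Y k @^-1` B) = P A * P (Y k @^-1` B).
Proof.
move=> mA mB; pose indepB (A : set Om) :=
  P (A `&` Y k @^-1` B) = P A * P (Y k @^-1` B).
have mYB : measurable (Y k @^-1` B) by exact: measurable_funPTI.
apply: (@dynkin_induction _ (past k) (cylinders k) indepB) mA => //.
- move=> _ _ [A1 mA1 ->] [A2 mA2 ->]; exists (fun i => A1 i `&` A2 i).
    by move=> i; exact: measurableI.
  by apply/seteqP; split=> w; [move=> [w1 w2] i ik; split;
    [exact: w1|exact: w2]|
    move=> w12; split=> i ik; have [] := w12 i ik].
- by rewrite /indepB setTI probability_setT mul1e.
- move=> _ [A1 mA1 ->]; rewrite /indepB P_cylinder//.
  (* The condition on [Y k] becomes the coordinate [k] of a longer cylinder. *)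
  pose A2 i := if (i < k)%N then A1 i else B.
  have mA2 i : measurable (A2 i) by rewrite /A2; case: ifP.
  rewrite (_ : _ `&` _ = \bigcap_(i in [set i | (i < k.+1)%N]) (Y i @^-1` A2
    i)).
    rewrite P_cylinder// big_ord_recr /= {2}/A2 ltnn; congr (_ * _).
    by apply: eq_bigr => i _; rewrite /A2 ltn_ord.
  apply/seteqP; split=> w.
    move=> [wA wB] i /=; rewrite ltnS leq_eqVlt => /predU1P[->|ik].
      by rewrite /A2 ltnn.
    by rewrite /A2 ik; exact: wA.
  move=> wA; split=> [i /= ik|].
    by have := wA i (leqW ik); rewrite /= /A2 ik.
  by have := wA k (leqnn _); rewrite /= /A2 ltnn.
- move=> S mS PS; rewrite /indepB setIC -setDE.
  have mS' := past_sub mS.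
  rewrite measureD//; last by rewrite ltey_eq fin_num_measure.
  rewrite [X in _ - P X]setIC PS probability_setC// muleBl ?mul1e//.
    by rewrite fin_num_measure.
- move=> F mF tF PF; rewrite /indepB setI_bigcupl.
  have mF' n : measurable (F n : set Om) by exact: past_sub.
  rewrite measure_bigcup//=; last 2 first.
  + by move=> n _; exact: measurableI.
  + by apply: trivIset_setIr.
  have YBE : P (Y k @^-1` B) = (fine (P (Y k @^-1` B)))%:E.
    by rewrite fineK// fin_num_measure.
  rewrite measure_bigcup// muleC YBE -nneseriesZl//.
  by apply: eq_eseriesr => n _; rewrite -YBE muleC; exact: PF.
Qed.

Lemma integral_past_indep k (g : R -> R) (F : past k -> R) :
  measurable_fun setT F -> measurable_fun setT g ->
  (forall w, 0 <= F w)%R -> (forall y, 0 <= g y)%R ->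
  \int[P]_w (F w * g (Y k w))%:E =
  (\int[P]_w (F w)%:E) * (\int[P]_w (g (Y k w))%:E).
Proof.
move=> mF mg F0 g0.
pose idk : {mfun Om >-> past k} :=
  HB.pack (id : Om -> past k) (isMeasurableFun.Build _ _ _ _ _
    (@measurable_past_id k)).
by apply: (@ge0_integral_indep _ (past k) _ _ idk (Y k) F g) => // A B mA mB;
  exact: past_indep.
Qed.

End independence.

Section measurable_chain.
Context d (T : measurableType d) (R : realType) (rec : bool) (a del : R).

(** [state] carries no sigma-algebra, so measurability is componentwise. The source [T] is arbitrary
    in order to cover both [Om] and [past k]. *)
Record measurable_state (s : T -> state R) : Prop := {
  measurable_nevents : measurable_fun setT (fun w => nevents (s w)) ;
  measurable_level : measurable_fun setT (fun w => level (s w)) ;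
  measurable_peak : measurable_fun setT (fun w => peak (s w)) ;
  measurable_pos : measurable_fun setT (fun w => pos (s w)) }.

Lemma measurable_event (s : T -> state R) (x : T -> R) :
  measurable_state s -> measurable_fun setT x ->
  measurable_fun setT (fun w => event rec a del (s w) (x w)).
Proof.
move=> [_ ml mp _] mx; rewrite /event.
apply: measurable_and.
  by apply: measurable_fun_ler => //; apply: measurable_funB => //;
    exact: measurable_maxr.
case: (rec) => /=; last exact: measurable_cst.
by apply: measurable_fun_ltr; [exact: measurable_funD|exact: measurable_maxr].
Qed.

Lemma measurable_step (s : T -> state R) (y : T -> R) :
  measurable_state s -> measurable_fun setT y ->
  measurable_state (fun w => step rec a del (s w) (y w)).
Proof.
move=> ms my; have [mn ml mp mx] := ms.
have mxy : measurable_fun setT (fun w => pos (s w) + y w) by exact: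
  measurable_funD.
have me := measurable_event ms mxy.
have mm : measurable_fun setT (fun w => Num.max (peak (s w)) (pos (s w) + y w)).
  exact: measurable_maxr.
split.
- rewrite [X in measurable_fun _ X](_ : _ = fun w =>
    if event rec a del (s w) (pos (s w) + y w) then (nevents (s w)).+1
    else nevents (s w)).
    by apply: measurable_fun_ifT => //; exact: measurableT_comp mn.
  by apply/funext => w; rewrite /step; case: ifP.
- rewrite [X in measurable_fun _ X](_ : _ = fun w =>
    if event rec a del (s w) (pos (s w) + y w) then
      Num.max (level (s w)) (Num.max (peak (s w)) (pos (s w) + y w))
    else level (s w)).
    by apply: measurable_fun_ifT => //; exact: measurable_maxr.
  by apply/funext => w; rewrite /step; case: ifP.
- rewrite [X in measurable_fun _ X](_ : _ = fun w =>
    if event rec a del (s w) (pos (s w) + y w) then pos (s w) + y w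
    else Num.max (peak (s w)) (pos (s w) + y w)).
    exact: measurable_fun_ifT.
  by apply/funext => w; rewrite /step; case: ifP.
- rewrite [X in measurable_fun _ X](_ : _ = fun w => pos (s w) + y w)//.
  by apply/funext => w; rewrite /step; case: ifP.
Qed.

Lemma measurable_chain (Y : nat -> T -> R) k :
  (forall i, (i < k)%N -> measurable_fun setT (Y i)) ->
  measurable_state (fun w => chain rec a del (Y^~ w) k).
Proof.
elim: k => [|k IH] mY; first by split; exact: measurable_cst.
by apply: measurable_step; [apply: IH => i ik; apply: mY;
  exact: leqW|exact: mY].
Qed.

Lemma measurable_event_at (Y : nat -> T -> R) k n :
  (forall i, (i <= k)%N -> measurable_fun setT (Y i)) ->
  measurable_fun setT (fun w => event_at rec a del (Y^~ w) k n).
Proof.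
move=> mY.
have ms : measurable_state (fun w => chain rec a del (Y^~ w) k).
  by apply: measurable_chain => i ik; apply: mY; exact: ltnW.
apply: measurable_and.
  by apply: measurable_event => //; apply: measurable_funD;
    [case: ms|exact: mY].
by apply: measurable_fun_eqn; [case: ms|exact: measurable_cst].
Qed.

Lemma measurable_nat_comp (f : nat -> R) (n : T -> nat) :
  measurable_fun setT n -> measurable_fun setT (f \o n).
Proof. by move=> mn; apply: measurableT_comp mn. Qed.

Variables (bp bm kap : R).

Lemma measurable_recovering (s : T -> state R) : measurable_state s ->
  measurable_fun setT (fun w => recovering rec del (s w)).
Proof.
move=> [_ ml mp _]; apply: measurable_and; first exact: measurable_cst.
by apply: measurable_fun_ler => //; exact: measurable_funD.
Qed.

Lemma measurable_weightp (s : T -> state R) : measurable_state s ->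
  measurable_fun setT (fun w => weightp bp bm rec del kap (s w)).
Proof.
move=> ms; have [_ ml mp mx] := ms.
apply: measurable_fun_ifT; first exact: measurable_recovering.
- apply: measurable_funM => //; apply: measurableT_comp => //.
  apply: measurable_funM => //; apply: measurable_funD => //.
  by apply: measurable_funB => //; exact: measurable_funD.
- apply: measurable_funM => //; apply: measurableT_comp => //.
  apply: measurable_funM => //; apply: measurable_funD => //.
  exact: measurable_funB.
Qed.

Lemma measurable_weightm (s : T -> state R) : measurable_state s ->
  measurable_fun setT (fun w => weightm bp bm rec del kap (s w)).
Proof.
move=> ms; have [_ ml mp mx] := ms.
apply: measurable_fun_ifT => //; first exact: measurable_recovering.
apply: measurable_funM => //; apply: measurableT_comp => //.
apply: measurable_funM => //; apply: measurable_funD => //.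
exact: measurable_funB.
Qed.

End measurable_chain.

Section discounted_event.
Context d (Om : measurableType d) (R : realType) (P : probability Om R).
Variable Y : nat -> {RV P >-> R}.
Hypothesis indepY : forall n, independent_RVs P (fun i : 'I_n => Y i).
Variables (bp bm : R) (rec : bool) (a del kap D : R) (N : nat).
Hypotheses (bp0 : 0 < bp) (bm0 : bm < 0) (a0 : 0 < a) (D0 : 0 < D).

Let st k (w : Om) : state R := chain rec a del (fun i => Y i w) k.

Let ev k (w : Om) : bool := event_at rec a del (fun i => Y i w) k N.

(** By [event_at_uniq] at most one term is nonzero: this is the discount factor at the time of the
    event number [N + 1], and 0 if it never happens. *)
Definition discounted_event (w : Om) : \bar R :=
  (\sum_(k <oo) (D ^+ k.+1 * (ev k w)%:R)%:E)%E.

Let x := renewal bp bm rec a del kap.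
Let F := pot bp bm (a + 2 * kap).

(** Each of the [N - n] events still to come before the paying one contributes a factor [x]; nothing
    is left after the payment. *)
Let dw (n : nat) : R := if (n <= N)%N then x ^+ (N - n) else 0.

Let x0 : 0 <= x.
Proof.
rewrite /x /renewal mulr_ge0 ?divr_ge0 ?(ltW (pot_gt0 _ _ _))//.
by case: (rec); rewrite ?expR_ge0.
Qed.

Let dw_ge0 n : 0 <= dw n.
Proof. by rewrite /dw; case: ifP => // _; rewrite exprn_ge0. Qed.

(** Makes the one-step inequality uniform over the events: the paying one yields 1 (times [F]), the
    earlier ones pass on the factor [x]. *)
Let dwE n : dw n = (n == N)%:R + x * dw n.+1.
Proof.
rewrite /dw; have [nN|Nn|->] := ltngtP n N.
- by rewrite add0r -exprS subnSK.
- by rewrite mulr0 addr0.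
- by rewrite subnn expr0 mulr0 addr0.
Qed.

Let wp k w := dw (nevents (st k w)) * weightp bp bm rec del kap (st k w).
Let wm k w := dw (nevents (st k w)) * weightm bp bm rec del kap (st k w).
Let v k w := dw (nevents (st k w)) * value bp bm rec del kap (st k w).

Let wp_ge0 k w : 0 <= wp k w.
Proof. by rewrite mulr_ge0// weightp_ge0. Qed.
Let wm_ge0 k w : 0 <= wm k w.
Proof. by rewrite mulr_ge0// weightm_ge0. Qed.
Let v_ge0 k w : 0 <= v k w.
Proof. by rewrite mulr_ge0// value_ge0. Qed.

Let vE k w : v k w = wp k w + wm k w.
Proof. by rewrite /v /value mulrDr. Qed.

Let mst k : measurable_state (st k).
Proof. exact: (measurable_chain rec a del (Y := fun i w => Y i w)). Qed.

Let mst_past k : measurable_state (st k : past Y k -> state R).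
Proof.
by apply: (measurable_chain rec a del (T := past Y k) (Y := fun i w => Y i w))
  => i; exact: measurable_past.
Qed.

Let mwp d' (T : measurableType d') (s : T -> state R) : measurable_state s ->
  measurable_fun setT (fun w => dw (nevents (s w)) * weightp bp bm rec del kap
    (s w)).
Proof.
move=> ms; apply: measurable_funM; last exact: measurable_weightp.
by case: ms => mn _ _ _; exact: measurable_nat_comp mn.
Qed.

Let mwm d' (T : measurableType d') (s : T -> state R) : measurable_state s ->
  measurable_fun setT (fun w => dw (nevents (s w)) * weightm bp bm rec del kap
    (s w)).
Proof.
move=> ms; apply: measurable_funM; last exact: measurable_weightm.
by case: ms => mn _ _ _; exact: measurable_nat_comp mn.
Qed.

Let mv k : measurable_fun setT (v k).
Proof.
rewrite (_ : v k = wp k \+ wm k); last by apply/funext => w; rewrite vE.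
by apply: measurable_funD; [exact: mwp|exact: mwm].
Qed.

Let mev k : measurable_fun setT (fun w => (ev k w)%:R : R).
Proof.
apply: (measurable_nat_comp (fun n : nat => n%:R) (n := fun w => nat_of_bool
  (ev k w))).
apply: (measurableT_comp (f := nat_of_bool)) => //.
exact: (measurable_event_at rec a del (Y := fun i w => Y i w)).
Qed.

Local Open Scope ereal_scope.

Let V k := \int[P]_w (v k w)%:E.
Let E k := \int[P]_w ((ev k w)%:R)%:E.

Let V_ge0 k : 0 <= V k.
Proof. by apply: integral_ge0 => w _; rewrite lee_fin. Qed.
Let E_ge0 k : 0 <= E k.
Proof. by apply: integral_ge0 => w _; rewrite lee_fin. Qed.

Lemma integral_discounted_event :
  \int[P]_w discounted_event w = \sum_(k <oo) (D ^+ k.+1)%:E * E k.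
Proof.
rewrite integral_nneseries//; last 2 first.
- by move=> k; apply/measurable_EFinP; apply: measurable_funM => //; exact: mev.
- by move=> k w _; rewrite lee_fin mulr_ge0 ?ler0n// exprn_ge0// ltW.
apply: eq_eseriesr => k _; under eq_integral do rewrite EFinM.
rewrite ge0_integralZl//; first exact/measurable_EFinP/mev.
by rewrite lee_fin exprn_ge0// ltW.
Qed.

Let Wp_ge0 k : 0 <= \int[P]_w (wp k w)%:E.
Proof. by apply: integral_ge0 => w _; rewrite lee_fin. Qed.
Let Wm_ge0 k : 0 <= \int[P]_w (wm k w)%:E.
Proof. by apply: integral_ge0 => w _; rewrite lee_fin. Qed.

(** Splitting the value into its two exponentials yields products of a function of the past and a
    function of the next increment, to which independence applies. *)
Let integral_step k (fp fm : R -> R) :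
  measurable_fun setT fp -> measurable_fun setT fm ->
  (forall y, 0 <= fp y)%R -> (forall y, 0 <= fm y)%R ->
  \int[P]_w (wp k w * fp (Y k w) + wm k w * fm (Y k w))%:E =
  (\int[P]_w (wp k w)%:E) * (\int[P]_w (fp (Y k w))%:E) +
  (\int[P]_w (wm k w)%:E) * (\int[P]_w (fm (Y k w))%:E).
Proof.
move=> mfp mfm fp0 fm0; under eq_integral do rewrite EFinD.
rewrite ge0_integralD//.
- congr (_ + _).
  + by apply: (integral_past_indep indepY (F := wp k)) => //;
      exact: mwp (mst_past k).
  + by apply: (integral_past_indep indepY (F := wm k)) => //;
      exact: mwm (mst_past k).
- by move=> w _; rewrite lee_fin mulr_ge0.
- apply/measurable_EFinP/measurable_funM; first exact: mwp.
  exact: measurableT_comp.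
- by move=> w _; rewrite lee_fin mulr_ge0.
- apply/measurable_EFinP/measurable_funM; first exact: mwm.
  exact: measurableT_comp.
Qed.

Let VE k : V k = \int[P]_w (wp k w)%:E + \int[P]_w (wm k w)%:E.
Proof.
rewrite /V; under eq_integral do rewrite vE EFinD.
by rewrite ge0_integralD//;
  [|exact/measurable_EFinP/mwp| |exact/measurable_EFinP/mwm];
  move=> w _; rewrite lee_fin.
Qed.

Let integral_next k : F%:E * E k + V k.+1 =
  \int[P]_w (F * (ev k w)%:R + v k.+1 w)%:E.
Proof.
under eq_integral do rewrite EFinD.
rewrite ge0_integralD//; last 4 first.
- by move=> w _; rewrite lee_fin mulr_ge0// ltW// pot_gt0.
- by apply/measurable_EFinP; apply: measurable_funM => //; exact: mev.
- by move=> w _; rewrite lee_fin.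
- exact/measurable_EFinP.
congr (_ + _); under eq_integral do rewrite EFinM.
rewrite ge0_integralZl//; first exact/measurable_EFinP/mev.
by rewrite lee_fin ltW// pot_gt0.
Qed.

Let st0 : V 0 = (x ^+ N * value bp bm rec del kap (State 0 0 0 0))%:E.
Proof.
rewrite /V (_ : (fun _ => _) = cst (x ^+ N * value bp bm rec del kap (State 0 0
  0 0))%:E).
  by rewrite integral_cst//= probability_setT mule1.
by apply/funext => w; rewrite /v /= /dw leq0n subn0.
Qed.

(** Supermartingale side: past payments plus the discounted value have nonincreasing mean, and the
    remaining value, being nonnegative, is dropped. *)
Lemma integral_discounted_event_le : kap = 0%R -> (- a < del)%R ->
  (forall k, \int[P]_w (expR (bp * Y k w))%:E <= (D^-1)%:E) ->
  (forall k, \int[P]_w (expR (bm * Y k w))%:E <= (D^-1)%:E) ->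
  F%:E * \int[P]_w discounted_event w <=
  (x ^+ N * value bp bm rec del kap (State 0 0 0 0))%:E.
Proof.
move=> kap0 adel mgfp mgfm.
have step k : F%:E * E k + V k.+1 <= (D^-1)%:E * V k.
  rewrite integral_next; apply: (@le_trans _ _ (\int[P]_w
      (wp k w * expR (bp * Y k w) + wm k w * expR (bm * Y k w))%:E)).
    apply: ge0_le_integral => //.
    - by move=> w _; rewrite lee_fin addr_ge0// mulr_ge0// ltW// pot_gt0.
    - apply/measurable_EFinP/measurable_funD => //.
      by apply: measurable_funM => //; exact: mev.
    - apply/measurable_EFinP/measurable_funD; apply: measurable_funM;
        do ?[exact: mwp|exact: mwm]; apply: measurableT_comp => //;
        exact: measurable_funM.
    - move=> w _; rewrite lee_fin /v /wp /wm /ev /event_at /= -/(st k w).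
      rewrite -2!mulrA -mulrDr.
      have [e|ne] /= := boolP (event rec a del (st k w) (pos (st k w) + Y k w)).
        have [le1 le2] := value_event_le bp0 bm0 a0 kap0 adel e.
        apply: le_trans (ler_wpM2l (dw_ge0 _) le2).
        rewrite [leRHS]mulrC [in leRHS]dwE [leRHS]mulrDr lerD2l.
        have -> : nevents (st k.+1 w) = (nevents (st k w)).+1.
          by rewrite /st /= /step ifT.
        by rewrite [leRHS]mulrC -mulrA [leRHS]mulrCA ler_wpM2l.
      have -> : nevents (st k.+1 w) = nevents (st k w).
        by rewrite /st /= /step ifN.
      rewrite mulr0 add0r.
      apply: ler_wpM2l => //; exact: value_step_le.
  rewrite (integral_step k (fp := fun y => expR (bp * y)) (fm := fun y => expR
    (bm * y)));
    do ?[by move=> y; exact: expR_ge0|apply: measurableT_comp => //;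
      exact: measurable_funM].
  rewrite VE [leRHS]muleC [leRHS]ge0_muleDl//.
  by apply: leeD; apply: lee_wpmul2l.
have sums K : \sum_(0 <= k < K) (D ^+ k.+1)%:E * (F%:E * E k) +
    (D ^+ K)%:E * V K <= V 0.
  elim: K => [|K IH]; first by rewrite big_geq// add0e expr0 mul1e.
  rewrite big_nat_recr//= -addeA; apply: le_trans IH; apply: leeD => //.
  rewrite -ge0_muleDr ?mule_ge0 ?lee_fin ?(ltW (pot_gt0 _ _ _))//.
  rewrite exprS mulrC EFinM -muleA; apply: lee_wpmul2l.
    by rewrite lee_fin exprn_ge0// ltW.
  rewrite -(@lee_pmul2l _ (D^-1)%:E) ?lte_fin ?invr_gt0//.
  by rewrite muleA -EFinM mulVf ?mul1e ?step// gt_eqF.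
rewrite integral_discounted_event -nneseriesZl; last first.
  by move=> k _; rewrite mule_ge0// lee_fin exprn_ge0// ltW.
rewrite -st0; apply: lime_le.
  apply: is_cvg_nneseries => k _ _.
  by rewrite mule_ge0 ?mule_ge0 ?lee_fin ?exprn_ge0 ?(ltW D0) ?(ltW (pot_gt0 _
    _ _)).
apply: nearW => K; apply: le_trans (sums K).
rewrite -[leLHS]adde0; apply: leeD; last first.
  by rewrite mule_ge0// lee_fin exprn_ge0// ltW.
by under eq_bigr do rewrite muleCA.
Qed.

Let wf k w : well_formed rec a del (st k w).
Proof.
case: k => [|k]; last exact: step_well_formed.
by split => //= _; rewrite subr0.
Qed.

(** Powers of [1 + x] give a bound uniform in [k] without comparing [x] with 1. *)
Let V_le k : (0 <= kap)%R -> V k <=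
  ((1 + x) ^+ N * (pot bp bm (a + kap) + pot bp bm kap))%:E.
Proof.
move=> kap0; set M := (_ * _)%R.
apply: (@le_trans _ _ (\int[P]_w (cst M%:E w))).
  apply: ge0_le_integral => //.
  - by move=> w _; rewrite lee_fin.
  - exact/measurable_EFinP.
  move=> w _; rewrite lee_fin; apply: ler_pM => //.
  - exact: value_ge0 bp0 bm0 _ _ _ _.
  - have x1 : (1 <= 1 + x)%R by rewrite lerDl.
    rewrite /dw; case: ifP => _; last by rewrite exprn_ge0// (le_trans _ x1).
    apply: (@le_trans _ _ ((1 + x) ^+ (N - nevents (st k w)))%R).
      by apply: lerXn2r; rewrite ?nnegrE ?addr_ge0// lerDr.
    by rewrite ler_weXn2l// leq_subr.
  - exact: value_le.
by rewrite integral_cst//= probability_setT mule1.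
Qed.

(** Submartingale side: the remaining value [D ^ K * V K] tends to 0 by [V_le] and [D < 1]. *)
Lemma integral_discounted_event_ge :
  (0 <= kap)%R -> (0 <= del)%R -> (D < 1)%R ->
  (forall k, (D^-1)%:E <=
     \int[P]_w (expR (bp * Y k w) * (`|Y k w| <= kap)%R%:R)%:E) ->
  (forall k, (D^-1)%:E <=
     \int[P]_w (expR (bm * Y k w) * (`|Y k w| <= kap)%R%:R)%:E) ->
  (x ^+ N * value bp bm rec del kap (State 0 0 0 0))%:E <=
  F%:E * \int[P]_w discounted_event w.
Proof.
move=> kap0 del0 D1 mgfp mgfm.
pose f b (y : R) : R := (expR (b * y) * (`|y| <= kap)%R%:R)%R.
have f0 b y : (0 <= f b y)%R by rewrite mulr_ge0 ?expR_ge0.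
have mf b : measurable_fun setT (f b).
  apply: measurable_funM; first by apply: measurableT_comp => //;
    exact: measurable_funM.
  apply: (measurableT_comp (f := fun b : bool => b%:R : R)) => //.
  by apply: measurable_fun_ler => //; exact: measurableT_comp.
have step k : (D^-1)%:E * V k <= F%:E * E k + V k.+1.
  rewrite integral_next; apply: (@le_trans _ _ (\int[P]_w
      (wp k w * f bp (Y k w) + wm k w * f bm (Y k w))%:E)).
    rewrite integral_step// VE [leLHS]muleC [leLHS]ge0_muleDl//.
    by apply: leeD; apply: lee_wpmul2l => //; [exact: mgfp|exact: mgfm].
  apply: ge0_le_integral => //.
  - by move=> w _; rewrite lee_fin addr_ge0// mulr_ge0.
  - by apply/measurable_EFinP/measurable_funD; apply: measurable_funM;
      do ?[exact: mwp|exact: mwm]; apply: measurableT_comp.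
  - apply/measurable_EFinP/measurable_funD => //.
    by apply: measurable_funM => //; exact: mev.
  - move=> w _; rewrite lee_fin /f.
    (* A large increment contributes 0 on the left and a nonnegative amount on the right. *)
    case: (boolP (_ <= kap)%R) => yk; last first.
      by rewrite !mulr0 addr0 addr_ge0// mulr_ge0// ltW// pot_gt0.
    rewrite !mulr1 /v /wp /wm /ev /event_at /= -/(st k w).
    rewrite -2!mulrA -mulrDr.
    have [e|ne] /= := boolP (event rec a del (st k w) (pos (st k w) + Y k w)).
      have [le1 le2] := value_event_ge bp0 bm0 a0 (wf k w) yk del0 e.
      apply: le_trans (ler_wpM2l (dw_ge0 _) le2) _.
      rewrite [leLHS]mulrC [in leLHS]dwE [leLHS]mulrDr lerD2l.
      have -> : nevents (st k.+1 w) = (nevents (st k w)).+1.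
        by rewrite /st /= /step ifT.
      by rewrite [leLHS]mulrC -mulrA [leLHS]mulrCA ler_wpM2l.
    have -> : nevents (st k.+1 w) = nevents (st k w).
      by rewrite /st /= /step ifN.
    rewrite mulr0 add0r.
    by apply: ler_wpM2l => //; exact: value_step_ge.
have sums K : V 0 <= \sum_(0 <= k < K) (D ^+ k.+1)%:E * (F%:E * E k) +
    (D ^+ K)%:E * V K.
  elim: K => [|K IH]; first by rewrite big_geq// add0e expr0 mul1e.
  rewrite big_nat_recr//= -addeA; apply: le_trans IH _; apply: leeD => //.
  rewrite -ge0_muleDr ?mule_ge0 ?lee_fin ?(ltW (pot_gt0 _ _ _))//.
  rewrite exprS mulrC EFinM -muleA; apply: lee_wpmul2l.
    by rewrite lee_fin exprn_ge0// ltW.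
  rewrite -(@lee_pmul2l _ (D^-1)%:E) ?lte_fin ?invr_gt0//.
  by rewrite [leRHS]muleA -EFinM mulVf ?mul1e ?step// gt_eqF.
rewrite integral_discounted_event -nneseriesZl; last first.
  by move=> k _; rewrite mule_ge0// lee_fin exprn_ge0// ltW.
rewrite -st0; apply/lee_addgt0Pr => e e0.
have [K DK] : exists K, (D ^+ K * ((1 + x) ^+ N * (pot bp bm (a + kap) + pot bp
  bm kap)) < e)%R.
  set M := (_ * (_ + _))%R.
  have M0 : (0 < M)%R.
    apply: mulr_gt0; first by rewrite exprn_gt0// (lt_le_trans ltr01)// lerDl.
    by rewrite addr_gt0// pot_gt0.
  have /cvgrPdist_lt/(_ _ (divr_gt0 e0 M0))[K _ HK] : (GRing.exp D : R^nat) @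
    \oo --> 0%R.
    by apply: cvg_expr; rewrite ger0_norm// ltW.
  exists K; rewrite -ltr_pdivlMr//; have := HK K (leqnn _).
  by rewrite /= sub0r normrN ger0_norm// exprn_ge0// ltW.
apply: le_trans (sums K) _; apply: leeD; last first.
  rewrite (le_trans (lee_wpmul2l _ (V_le K _)))//;
    first by rewrite lee_fin exprn_ge0// ltW.
  by rewrite -EFinM lee_fin ltW.
under [leLHS]eq_bigr do rewrite muleCA.
apply: nneseries_lim_ge => k _ _.
by rewrite mule_ge0 ?mule_ge0 ?lee_fin ?exprn_ge0 ?(ltW D0) ?(ltW (pot_gt0 _ _
  _)).
Qed.

End discounted_event.

(** * Increments of the log-price *)

Section density.
Context d (T : measurableType d) (R : realType).
Variables (mu nu : {measure set T -> \bar R}) (g : T -> R).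
Hypotheses (g0 : forall x, 0 <= g x) (mg : measurable_fun setT g).
Local Open Scope ereal_scope.
Hypothesis nuE : forall A, measurable A -> nu A = \int[mu]_(x in A) (g x)%:E.

Import HBNNSimple.

Let mgE : measurable_fun setT (EFin \o g).
Proof. exact/measurable_EFinP. Qed.

Let integral_density_nnsfun (h : {nnsfun T >-> R}) :
  \int[nu]_x (h x)%:E = \int[mu]_x ((h x)%:E * (g x)%:E).
Proof.
transitivity (\sum_(y \in range h) y%:E * nu (h @^-1` [set y])).
  under eq_integral do rewrite fimfunE -fsumEFin//.
  rewrite ge0_integral_fsum//; last 2 first.
  - by move=> y; apply/measurable_EFinP; exact: measurable_funM.
  - by move=> y x _; rewrite EFinM nnfun_muleindic_ge0.
  by apply: eq_fsbigr => y _;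
    rewrite integralZl_indic_nnsfun// integral_indic// setIT.
transitivity (\int[mu]_x (\sum_(y \in range h)
    (y * \1_(h @^-1` [set y]) x)%:E * (g x)%:E)); last first.
  apply: eq_integral => x _; rewrite -ge0_mule_fsuml; last first.
    by move=> y; rewrite EFinM nnfun_muleindic_ge0.
  by rewrite fsumEFin// -fimfunE.
rewrite ge0_integral_fsum//; last 2 first.
- by move=> y; apply: emeasurable_funM => //;
    exact/measurable_EFinP/measurable_funM.
- move=> y x _; apply: mule_ge0; last by rewrite lee_fin.
  by rewrite EFinM nnfun_muleindic_ge0.
apply: eq_fsbigr => y /[!inE] -[x _ <-].
under [RHS]eq_integral do rewrite EFinM -muleA.
rewrite ge0_integralZl//; last 3 first.
- by apply: emeasurable_funM => //; exact/measurable_EFinP.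
- by move=> z _; rewrite mule_ge0 ?lee_fin.
- by rewrite lee_fin.
congr (_ * _); rewrite nuE// integral_mkcond; apply: eq_integral => z _.
by rewrite epatch_indic muleC.
Qed.

Lemma ge0_integral_density (f : T -> \bar R) :
  measurable_fun setT f -> (forall x, 0 <= f x) ->
  \int[nu]_x f x = \int[mu]_x (f x * (g x)%:E).
Proof.
move=> mf f0; pose h := nnsfun_approx measurableT mf.
have hf x : (h n x)%:E @[n --> \oo] --> f x by exact: cvg_nnsfun_approx.
have h_nd x : {homo (fun n => (h n x)%:E) : m n / (m <= n)%N >-> m <= n}.
  by move=> m n mn; rewrite lee_fin; exact/lefP/nd_nnsfun_approx.
transitivity (limn (fun n => \int[nu]_x (h n x)%:E)).
  rewrite -monotone_convergence//.
  - by apply: eq_integral => x _; apply/esym/cvg_lim.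
  - by move=> n; exact/measurable_EFinP.
  - by move=> n x _; rewrite lee_fin.
under eq_fun do rewrite integral_density_nnsfun.
rewrite -monotone_convergence//.
- apply: eq_integral => x _; apply/cvg_lim => //.
  by apply: cvgeZr => //; exact: hf.
- by move=> n; apply: emeasurable_funM => //; exact/measurable_EFinP.
- by move=> n x _; rewrite mule_ge0 ?lee_fin.
- by move=> x _ m n mn; rewrite lee_wpmul2r ?lee_fin//; exact: h_nd.
Qed.

End density.

(** Completing the square turns the integrand into a constant times the normal density of mean
    [b * s ^+ 2]. *)
Lemma normal_mgf (R : realType) (s b : R) : s != 0 ->
  (\int[normal_prob 0 s]_x (expR (b * x))%:E = (expR (2^-1 * b ^+ 2 * s ^+
    2))%:E)%E.
Proof.
move=> s0.
rewrite (@ge0_integral_density _ _ _ lebesgue_measure _ (normal_pdf 0 s)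
  (normal_pdf_ge0 0 s) (measurable_normal_pdf 0 s))//; last first.
  by apply/measurable_EFinP; apply: measurableT_comp => //;
    exact: measurable_funM.
transitivity (\int[lebesgue_measure]_x
   ((expR (2^-1 * b ^+ 2 * s ^+ 2))%:E * (normal_pdf (b * s ^+ 2) s x)%:E))%E.
  apply: eq_integral => x _; rewrite -!EFinM; congr EFin.
  rewrite !normal_pdfE// mulrCA [RHS]mulrCA; congr (_ * _).
  rewrite /normal_fun -!expRD; congr expR.
  by field.
rewrite ge0_integralZl//; last 2 first.
- by apply/measurable_EFinP; exact: measurable_normal_pdf.
- by move=> x _; rewrite lee_fin normal_pdf_ge0.
by rewrite integral_normal_pdf mule1.
Qed.

Section truncated_mgf.
Context d (Om : measurableType d) (R : realType) (P : probability Om R).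
Variables (mu sigma : R).

Definition cumulant (b : R) : R := mu * b + 2^-1 * sigma ^+ 2 * b ^+ 2.

Definition has_cumulant (h : R) (Z : Om -> R) : Prop :=
  forall b, (\int[P]_w (expR (b * Z w))%:E = (expR (cumulant b * h))%:E)%E.

(** Where [|Z| > kap], one of [e^(t (Z - kap))] and [e^(t (- Z - kap))] is at least 1, so [e^(b Z)]
    is at most [e^(- t kap) (e^((b + t) Z) + e^((b - t) Z))]. *)
Lemma truncated_mgf (Z : Om -> R) (h b kap t : R) :
  measurable_fun setT Z -> has_cumulant h Z -> 0 <= t ->
  ((expR (cumulant b * h))%:E <=
   \int[P]_w (expR (b * Z w) * (`|Z w| <= kap)%R%:R)%:E +
   (expR (- t * kap) * (expR (cumulant (b + t) * h) +
                        expR (cumulant (b - t) * h)))%:E)%E.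
Proof.
move=> mZ hZ t0.
have mexp b' : measurable_fun setT (fun w => (expR (b' * Z w))%:E).
  by apply/measurable_EFinP; apply: measurableT_comp => //;
    exact: measurable_funM.
have mtr : measurable_fun setT
    (fun w => (expR (b * Z w) * (`|Z w| <= kap)%R%:R)%:E).
  apply/measurable_EFinP; apply: measurable_funM.
    by apply: measurableT_comp => //; exact: measurable_funM.
  apply: (measurableT_comp (f := fun b : bool => b%:R : R)) => //.
  by apply: measurable_fun_ler => //; exact: measurableT_comp.
have exp_ge0 b' w : (0 <= (expR (b' * Z w))%:E)%E by rewrite lee_fin expR_ge0.
rewrite EFinM EFinD -(hZ b) -(hZ (b + t)) -(hZ (b - t)).
rewrite -ge0_integralD// -ge0_integralZl//; last 2 first.
- exact: emeasurable_funD.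
- by move=> w _; rewrite adde_ge0.
rewrite -ge0_integralD//; last 2 first.
- by move=> w _; rewrite mule_ge0 ?adde_ge0// lee_fin expR_ge0.
- by apply: emeasurable_funM => //; exact: emeasurable_funD.
apply: ge0_le_integral => //.
- by apply: emeasurable_funD => //; apply: emeasurable_funM => //;
    exact: emeasurable_funD.
- move=> w _; rewrite -!(EFinD, EFinM) lee_fin.
  case: (boolP (_ <= kap)%R) => zk.
    by rewrite mulr1 lerDl mulr_ge0 ?addr_ge0 ?expR_ge0.
  rewrite mulr0 add0r mulrDr -!expRD.
  move: zk; rewrite -ltNge ltr_normr => /orP[kz|kz].
    rewrite -[leLHS]addr0 lerD ?expR_ge0// ler_expR.
    have : 0 <= t * (Z w - kap) by rewrite mulr_ge0// subr_ge0 ltW.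
    lra.
  rewrite -[leLHS]add0r lerD ?expR_ge0// ler_expR.
  have : 0 <= t * (- Z w - kap) by rewrite mulr_ge0// subr_ge0 ltW.
  lra.
Qed.

Lemma cumulant_le (b t h : R) : 0 <= h <= 1 -> t ^+ 2 * h <= 1 -> `|t| * h <= 1
  ->
  cumulant (b + t) * h <=
  `|mu| * (`|b| + 1) + 2^-1 * sigma ^+ 2 * (`|b| + 1) ^+ 2.
Proof.
move=> /andP[h0 h1] t2 t1; rewrite /cumulant mulrDl lerD//.
  rewrite (le_trans (ler_norm _))// !normrM -mulrA ler_wpM2l//.
  rewrite (ger0_norm h0) (le_trans (ler_wpM2r h0 (ler_normD _ _)))//.
  by rewrite mulrDl lerD// ler_piMr.
rewrite -[leLHS]mulrA; apply: ler_wpM2l; first by rewrite mulr_ge0 ?sqr_ge0.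
have bt : b * t * h <= `|b|.
  rewrite (le_trans (ler_norm _))// !normrM -mulrA ler_piMr//.
  by rewrite (ger0_norm h0).
have b2 : b ^+ 2 * h <= `|b| ^+ 2 by rewrite -normrX ger0_norm ?sqr_ge0//
  ler_piMr ?sqr_ge0.
rewrite !sqrrD; lra.
Qed.

Lemma truncated_mgf_near (b q q' kap : R) : cumulant b = q -> 0 <= q' < q ->
  0 < kap ->
  \forall n \near \oo, forall Z : Om -> R, measurable_fun setT Z ->
    has_cumulant n.+1%:R^-1 Z ->
    ((expR (q' * n.+1%:R^-1))%:E <=
      \int[P]_w (expR (b * Z w) * (`|Z w| <= kap)%R%:R)%:E)%E.
Proof.
move=> bq /andP[q'0 q'q] kap0.
pose C := `|mu| * (`|b| + 1) + 2^-1 * sigma ^+ 2 * (`|b| + 1) ^+ 2.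
have qq0 : 0 < q - q' by rewrite subr_gt0.
(* With [t ^+ 2 = 1 / h] and [e^y >= y^4 / 24], the tail is at most [48 e^C h^2 / kap^4], which is
   below [(q - q') h] once [1 / h >= K]. A square would give only order [h], the order of the gap
   [e^(q h) - e^(q' h)] that has to absorb the tail. *)
pose K := 48 * expR C / (kap ^+ 4 * (q - q')).
exists (Num.truncn K).+1 => // n /= Kn Z mZ hZ.
set h := n.+1%:R^-1; have h0 : 0 < h by rewrite invr_gt0.
have h1 : h <= 1 by rewrite invf_le1// ler1n.
(* Chernoff's bound with [t = h^(-1/2)], for which [cumulant (b + t) * h] and
   [cumulant (b - t) * h] stay bounded. *)
pose t := Num.sqrt (n.+1%:R : R).
have t0 : 0 <= t by rewrite sqrtr_ge0.
have t2 : t ^+ 2 = n.+1%:R by rewrite sqr_sqrtr.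
have t2h : t ^+ 2 * h = 1 by rewrite t2 mulfV.
have t1 : t * h <= 1.
  rewrite -t2h ler_wpM2r ?(ltW h0)// expr2 ler_peMr//.
  by rewrite -sqrtr1 ler_sqrt// ler1n.
have tr := truncated_mgf b kap mZ hZ t0.
have tail : expR (- t * kap) * (expR (cumulant (b + t) * h) +
    expR (cumulant (b - t) * h)) <= (q - q') * h.
  have up : cumulant (b + t) * h <= C.
    by apply: cumulant_le; rewrite ?(ltW h0) ?t2h ?ger0_norm.
  have down : cumulant (b - t) * h <= C.
    by apply: cumulant_le; rewrite ?(ltW h0) ?sqrrN ?t2h ?normrN ?ger0_norm.
  apply: (@le_trans _ _ (expR (- t * kap) * (2 * expR C))).
    rewrite ler_wpM2l ?expR_ge0// mulr_natl mulr2n.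
    by rewrite lerD// ler_expR.
  have tk : (t * kap) ^+ 4 / 24 <= expR (t * kap).
    have := @expR_ge1Dxn R (t * kap) 3 (mulr_ge0 t0 (ltW kap0)).
    rewrite (_ : (4`!)%:R = 24)//; apply: le_trans.
    by rewrite lerDr.
  rewrite mulNr expRN ler_pdivrMl ?expR_gt0//.
  apply: le_trans (ler_wpM2r _ tk);
    last by rewrite mulr_ge0 ?(ltW qq0) ?(ltW h0).
  rewrite exprMn (_ : t ^+ 4 = t ^+ 2 * t ^+ 2); last by rewrite -exprD.
  rewrite [leRHS](_ : _ = (t ^+ 2 * h) * (t ^+ 2 * (kap ^+ 4 * (q - q')) /
    24)); last by ring.
  rewrite t2h mul1r t2 ler_pdivlMr//.
  rewrite [leLHS](_ : _ = 48 * expR C); last by ring.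
  rewrite -ler_pdivrMr ?mulr_gt0 ?exprn_gt0// -/K.
  apply: ltW; apply: lt_le_trans (truncnS_gt K) _.
  by rewrite ler_nat; exact: leqW.
have qh : expR (q' * h) + (q - q') * h <= expR (q * h).
  have e1 := expR_ge1Dx ((q - q') * h).
  have e2 : 1 <= expR (q' * h) by rewrite -expR0 ler_expR mulr_ge0// ltW.
  have -> : expR (q * h) = expR (q' * h) * expR ((q - q') * h).
    by rewrite -expRD; congr expR; ring.
  have qqh : 0 <= (q - q') * h by rewrite mulr_ge0 ?ltW.
  nra.
rewrite bq in tr.
have {}tr := le_trans tr (leeD (le_refl _) (eqbRL (lee_fin _ _) tail)).
rewrite -(@leeD2rE _ ((q - q') * h)%:E)// (le_trans _ tr)//.
Qed.

End truncated_mgf.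

Section roots.
Variables (R : realType) (r sigma q : R).
Hypotheses (sigma0 : 0 < sigma) (q0 : 0 < q).

Let mu := r - 2^-1 * sigma ^+ 2.
Let disc := mu ^+ 2 + 2 * q * sigma ^+ 2.

Let s2 : 0 < sigma ^+ 2. Proof. by rewrite exprn_gt0. Qed.

Let mu_lt : `|mu| < Num.sqrt disc.
Proof.
have qs0 : 0 < 2 * q * sigma ^+ 2 by rewrite !mulr_gt0.
have disc0 : 0 < disc by rewrite ltr_wpDl ?sqr_ge0.
by rewrite -sqrtr_sqr ltr_sqrt// ltrDl.
Qed.

Let disc_sqr : Num.sqrt disc ^+ 2 = disc.
Proof. by rewrite sqr_sqrtr// addr_ge0 ?sqr_ge0// mulr_ge0 ?(ltW s2)//
  mulr_ge0// ltW. Qed.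

Lemma betap_gt0 : 0 < betap r sigma q.
Proof.
rewrite /betap divr_gt0//.
have -> : - r + 2^-1 * sigma ^+ 2 = - mu by rewrite /mu; ring.
by rewrite addrC subr_gt0; apply: le_lt_trans mu_lt; exact: ler_norm.
Qed.

Lemma betam_lt0 : betam r sigma q < 0.
Proof.
rewrite /betam pmulr_llt0 ?invr_gt0//.
have -> : - r + 2^-1 * sigma ^+ 2 = - mu by rewrite /mu; ring.
by rewrite subr_lt0; apply: le_lt_trans mu_lt; rewrite ler_normr lexx orbT.
Qed.

Let cumulant_root (s : R) : s ^+ 2 = disc ->
  cumulant mu sigma ((- mu + s) / sigma ^+ 2) = q.
Proof.
move=> sE; rewrite /cumulant.
have -> : q = (s ^+ 2 - mu ^+ 2) / (2 * sigma ^+ 2).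
  by rewrite sE /disc; field; rewrite gt_eqF.
by field; rewrite gt_eqF.
Qed.

Lemma cumulant_betap : cumulant mu sigma (betap r sigma q) = q.
Proof.
rewrite -[RHS](cumulant_root disc_sqr) /betap; congr cumulant; congr (_ / _).
by rewrite /mu; ring.
Qed.

Lemma cumulant_betam : cumulant mu sigma (betam r sigma q) = q.
Proof.
have dN : (- Num.sqrt disc) ^+ 2 = disc by rewrite sqrrN.
rewrite -[RHS](cumulant_root dN) /betam; congr cumulant; congr (_ / _).
by rewrite /mu; ring.
Qed.

End roots.

Section brownian_skeleton.
Context (R : realType) (d : measure_display) (Om : measurableType d).
Variables (Q : probability Om R) (W : R -> {RV Q >-> R}) (r sigma : R).
Hypothesis hW : standard_brownian_motion W.

Let X := log_price r sigma (fun t w => W t w).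
Let mu := r - 2^-1 * sigma ^+ 2.

Definition mesh (n : nat) : R := n.+1%:R^-1.

Lemma mesh_gt0 n : 0 < mesh n. Proof. by rewrite invr_gt0. Qed.

Definition skeleton_increment (n k : nat) (w : Om) : R :=
  increments (fun t => X t w) (mesh n) k.

Let incrementE n k w : skeleton_increment n k w =
  mu * mesh n + sigma * (W (k.+1%:R * mesh n) w - W (k%:R * mesh n) w).
Proof.
by rewrite /skeleton_increment /increments /X /log_price -/mu -natr1; ring.
Qed.

Lemma measurable_skeleton_increment n k :
  measurable_fun setT (skeleton_increment n k).
Proof.
rewrite (_ : skeleton_increment n k = fun w =>
  mu * mesh n + sigma * (W (k.+1%:R * mesh n) w - W (k%:R * mesh n) w)).
  apply: measurable_funD => //; apply: measurable_funM => //.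
  exact: measurable_funB.
by apply/funext => w; exact: incrementE.
Qed.

HB.instance Definition _ n k := isMeasurableFun.Build _ _ _ _
  (skeleton_increment n k) (measurable_skeleton_increment n k).

Definition skeleton_RV (n k : nat) : {RV Q >-> R} := skeleton_increment n k.

Lemma skeleton_RV_indep n m :
  independent_RVs Q (fun i : 'I_m => skeleton_RV n i).
Proof.
move=> A mA.
pose t (k : nat) : R := k%:R * mesh n.
have t0 : 0 <= t 0%N by rewrite /t mul0r.
have nd_t : nondecreasing_seq t.
  by move=> i j ij; rewrite /t ler_wpM2r ?ler_nat// ltW// mesh_gt0.
pose f (x : R) := mu * mesh n + sigma * x.
have mf : measurable_fun setT f.
  by apply: measurable_funD => //; exact: measurable_funM.
have AE (i : 'I_m) : skeleton_RV n i @^-1` A i =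
    (fun w => W (t i.+1) w - W (t i) w) @^-1` (f @^-1` A i).
  by apply/funext => w; rewrite /preimage /= incrementE.
under eq_bigr do rewrite AE.
rewrite -(bm_indep hW t0 nd_t); last first.
  by move=> i; rewrite -[_ @^-1` _]setTI; exact: mf.
by congr (Q _); apply: eq_bigcapr => i _; exact: AE.
Qed.

Lemma skeleton_RV_cumulant n k : has_cumulant Q mu sigma (mesh n) (skeleton_RV
  n k).
Proof.
move=> b; set h := mesh n; pose s := k%:R * h.
pose D w := W (k.+1%:R * h) w - W s w.
have mD : measurable_fun setT D by exact: measurable_funB.
have h0 := mesh_gt0 n.
have s0 : 0 <= s by rewrite mulr_ge0// ltW.
have st : s < k.+1%:R * h by rewrite /s ltr_pM2r// ltr_nat.
have sh : k.+1%:R * h - s = h by rewrite /s -natr1; ring.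
under eq_integral => w _.
  rewrite /= incrementE -/h -/s -/(D w) mulrDr expRD [b * (sigma * _)]mulrA
    EFinM.
  over.
rewrite ge0_integralZl//; last first.
  by apply/measurable_EFinP; apply: measurableT_comp => //;
    exact: measurable_funM.
have -> : (\int[Q]_w (expR (b * sigma * D w))%:E =
    \int[normal_prob 0 (Num.sqrt h)]_x (expR (b * sigma * x))%:E)%E.
  pose D' : Om -> measurableTypeR R := D.
  have mD' : measurable_fun setT D' by exact: mD.
  pose DD : {mfun Om >-> measurableTypeR R} :=
    HB.pack D' (isMeasurableFun.Build _ _ _ _ D' mD').
  transitivity (\int[distribution Q DD]_x (expR (b * sigma * x))%:E)%E.
    rewrite ge0_integral_distribution//.
    by apply/measurable_EFinP; apply: measurableT_comp => //;
      exact: measurable_funM.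
  apply: eq_measure_integral => A mA _.
  by rewrite -sh; exact: (bm_normal hW s0 st mA).
rewrite normal_mgf; last by rewrite gt_eqF// sqrtr_gt0.
rewrite sqr_sqrtr ?(ltW h0)// -EFinM -expRD /cumulant; congr (expR _)%:E.
by rewrite -/h; ring.
Qed.

Variables (rec : bool) (a : R).
Hypotheses (sigma0 : 0 < sigma) (a0 : 0 < a).

Definition skeleton_discount (del q : R) (N n : nat) : Om -> \bar R :=
  discounted_event (skeleton_RV n) rec a del (expR (- q * mesh n)) N.

Lemma integral_skeleton_discount_le (del q : R) N n
    (bp := betap r sigma q) (bm := betam r sigma q) :
  0 < q -> - a < del < 0 ->
  (\int[Q]_w skeleton_discount del q N n w <=
   (renewal bp bm rec a del 0 ^+ N * (pot bp bm 0 / pot bp bm a))%:E)%E.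
Proof.
move=> q0 /andP[adel del0].
have bp0 : 0 < bp by exact: betap_gt0.
have bm0 : bm < 0 by exact: betam_lt0.
have D0 : 0 < expR (- q * mesh n) by exact: expR_gt0.
have mgf b k : cumulant mu sigma b = q ->
    (\int[Q]_w (expR (b * skeleton_RV n k w))%:E <= (expR (- q * mesh
      n))^-1%:E)%E.
  by move=> bE; rewrite skeleton_RV_cumulant bE mulNr expRN invrK.
have := integral_discounted_event_le (@skeleton_RV_indep n) rec N bp0 bm0 a0 D0
  (erefl 0) adel (fun k => mgf bp k (cumulant_betap r sigma0 q0))
  (fun k => mgf bm k (cumulant_betam r sigma0 q0)).
(* A negative margin makes the walk start outside recovery, with value [pot 0]. *)
have nrec : rec && (0 <= del) = false by rewrite leNgt del0 andbF.
rewrite valueE /recovering /= add0r nrec subrr addr0 mulr0 addr0.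
rewrite -lee_pdivlMl ?pot_gt0// => /le_trans; apply.
by rewrite -EFinM lee_fin mulrC mulrA.
Qed.

(** Discounting at [q'] while taking the roots at the larger [q] pays for the truncation of the
    increments. As [0 <= del], with recovery the walk starts recovering, which costs the extra
    exponential; it tends to 1 with [kap] and [del]. *)
Lemma integral_skeleton_discount_ge (del kap q q' : R) N
    (bp := betap r sigma q) (bm := betam r sigma q) :
  0 < q' < q -> 0 <= del -> 0 < kap ->
  \forall n \near \oo, ((renewal bp bm rec a del kap ^+ N *
    ((if rec then expR (- bp * (kap + del)) else 1) * pot bp bm kap /
     pot bp bm (a + 2 * kap)))%:E <=
  \int[Q]_w skeleton_discount del q' N n w)%E.
Proof.
move=> /andP[q'0 q'q] del0 kap0.
have q0 := lt_trans q'0 q'q.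
have bp0 : 0 < bp by exact: betap_gt0.
have bm0 : bm < 0 by exact: betam_lt0.
have q'q' : 0 <= q' < q by rewrite ltW.
have np := truncated_mgf_near Q (cumulant_betap r sigma0 q0) q'q' kap0.
have nm := truncated_mgf_near Q (cumulant_betam r sigma0 q0) q'q' kap0.
near=> n.
have D0 : 0 < expR (- q' * mesh n) by exact: expR_gt0.
have D1 : expR (- q' * mesh n) < 1.
  by rewrite -expR0 ltr_expR mulNr oppr_lt0 mulr_gt0// mesh_gt0.
have mgfp k : ((expR (- q' * mesh n))^-1%:E <= \int[Q]_w
    (expR (bp * skeleton_RV n k w) * (`|skeleton_RV n k w| <= kap)%R%:R)%:E)%E.
  rewrite mulNr expRN invrK; apply: (near np n) => //.
  exact: skeleton_RV_cumulant.
have mgfm k : ((expR (- q' * mesh n))^-1%:E <= \int[Q]_w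
    (expR (bm * skeleton_RV n k w) * (`|skeleton_RV n k w| <= kap)%R%:R)%:E)%E.
  rewrite mulNr expRN invrK; apply: (near nm n) => //.
  exact: skeleton_RV_cumulant.
have := integral_discounted_event_ge (@skeleton_RV_indep n) rec N bp0 bm0 a0 D0
  (ltW kap0) del0 D1 mgfp mgfm.
rewrite valueE /recovering /= add0r del0 andbT subr0 subrr add0r.
rewrite -lee_pdivrMl ?pot_gt0//; apply: le_trans.
rewrite -EFinM lee_fin le_eqVlt; apply/orP; left; apply/eqP.
by case: (rec) => /=; ring.
Unshelve. all: by end_near. Qed.

End brownian_skeleton.

(** * Passage to the limit *)

Section limn_einf_bounds.
Context (R : realType).
Local Open Scope ereal_scope.
Implicit Types (u : (\bar R)^nat) (c : \bar R).

Lemma le_limn_einf u c : (\forall n \near \oo, c <= u n) -> c <= limn_einf u.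
Proof.
move=> [N _ cu]; rewrite limn_einf_lim; apply: lime_ge;
  first exact: is_cvg_einfs.
exists N => // n /= Nn; apply: le_ereal_inf_tmp => _ [m /= nm <-].
by apply: cu => /=; exact: leq_trans nm.
Qed.

Lemma limn_einf_le u c : (\forall n \near \oo, u n <= c) -> limn_einf u <= c.
Proof.
move=> [N _ uc]; rewrite limn_einf_lim; apply: lime_le;
  first exact: is_cvg_einfs.
exists N => // n /= Nn; apply: ereal_inf_le; exists (u n); last exact: uc.
by exists n => /=.
Qed.

Lemma measurable_fun_limn_einf d (T : measurableType d) (f : (T -> \bar R)^nat)
  :
  (forall n, measurable_fun setT (f n)) ->
  measurable_fun setT (fun x => limn_einf (f ^~ x)).
Proof.
move=> mf; apply: (measurableT_comp (f := -%E)) => //.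
apply: (@measurable_fun_limn_esup _ _ _ _ (fun n x => - f n x)) => n.
exact: measurableT_comp.
Qed.

End limn_einf_bounds.

Section squeeze.
Context d (Om : measurableType d) (R : realType) (P : probability Om R).
Variables (N : set Om).
Hypotheses (mN : measurable N) (PN : P N = 0%E).
Local Open Scope ereal_scope.

(** A bound on the upper integral of [f], which is not assumed measurable. *)
Definition integral_dominated (f : Om -> R) (x : R) : Prop :=
  forall e, (0 < e)%R -> exists U : Om -> \bar R,
    [/\ measurable_fun setT U, forall w, 0 <= U w,
        forall w, ~ N w -> (f w)%:E <= U w & \int[P]_w U w <= (x + e)%:E].

Lemma integral_dominated_ex (f : Om -> R) (x : R) :
  (forall w, ~ N w -> f w <= 1)%R -> integral_dominated f x ->
  exists g : Om -> R, [/\ measurable_fun setT g,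
    forall w, (0 <= g w <= 1)%R, forall w, ~ N w -> (f w <= g w)%R &
    \int[P]_w (g w)%:E <= x%:E].
Proof.
move=> f1 dom.
have /choice[U UP] : forall n : nat, exists U : Om -> \bar R,
    [/\ measurable_fun setT U, forall w, 0 <= U w,
        forall w, ~ N w -> (f w)%:E <= U w & \int[P]_w U w <= (x +
          n.+1%:R^-1)%:E].
  by move=> n; apply: dom; rewrite invr_gt0.
(* The infimum of all the majorants, cut at 1 to be finite and integrable. *)
pose G w := mine (einfs (U^~ w) 0%N) 1.
have G0 w : 0 <= G w.
  rewrite /G le_min lee01 andbT; apply: le_ereal_inf_tmp => _ [n _ <-].
  by case: (UP n).
have G1 w : G w <= 1 by rewrite /G ge_min lexx orbT.
have Gfin w : G w \is a fin_num.
  by rewrite ge0_fin_numE// (le_lt_trans (G1 w))// ltry.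
have mG : measurable_fun setT G.
  apply: measurable_mine => //; apply: measurable_fun_einfs => n.
  by case: (UP n).
have GU n w : G w <= U n w.
  by rewrite /G ge_min; apply/orP; left; apply: ereal_inf_lbound; exists n.
exists (fine \o G); split.
- by apply: measurableT_comp => //; exact: measurable_fine.
- by move=> w; rewrite -!lee_fin /= fineK// G0 G1.
- move=> w Nw; rewrite -lee_fin /= fineK// /G le_min lee_fin f1// andbT.
  by apply: le_ereal_inf_tmp => _ [n _ <-]; case: (UP n) => _ _ + _; exact.
apply/lee_addgt0Pr => e e0.
have [n ne] : exists n : nat, (n.+1%:R^-1 < e)%R.
  have [n _ /(_ n)] := near_infty_natSinv_lt (PosNum e0).
  by move=> /(_ (leqnn _)); exists n.
have [mU U0 _ Un] := UP n.
apply: (@le_trans _ _ (\int[P]_w U n w)).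
  under eq_integral do rewrite /= fineK//.
  by apply: ge0_le_integral.
by rewrite (le_trans Un)// -EFinD lee_fin lerD2l ltW.
Qed.

(** Majorants [g] of [f] and [g'] of [1 - f] satisfy [g + g' >= 1] almost surely, while their
    integrals sum to at most 1; so [g + g' = 1] and [f = g] almost surely. *)
Lemma integral_squeeze (f : Om -> R) (x : R) :
  (forall w, ~ N w -> 0 <= f w <= 1)%R ->
  integral_dominated f x -> integral_dominated (fun w => 1 - f w)%R (1 - x)%R ->
  exists g : Om -> R, [/\ measurable_fun setT g,
    forall w, (0 <= g w <= 1)%R, {ae P, forall w, f w = g w} &
    \int[P]_w (g w)%:E = x%:E].
Proof.
move=> f01 dom1 dom2.
have [|g [mg g01 fg gx]] := integral_dominated_ex _ dom1.
  by move=> w /f01/andP[].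
have [|g' [mg' g'01 fg' gx']] := integral_dominated_ex _ dom2.
  by move=> w /f01/andP[f0 _]; rewrite lerBlDr lerDl.
have g0 w : (0 <= g w)%R by case/andP: (g01 w).
have g'0 w : (0 <= g' w)%R by case/andP: (g'01 w).
have mgE : measurable_fun setT (EFin \o g) by exact/measurable_EFinP.
have mgE' : measurable_fun setT (EFin \o g') by exact/measurable_EFinP.
have sum_le : \int[P]_w (g w + g' w)%:E <= 1.
  under eq_integral do rewrite EFinD.
  rewrite ge0_integralD//; do ?[by move=> w _; rewrite lee_fin].
  by rewrite (le_trans (leeD gx gx'))// -EFinD lee_fin addrC subrK.
(* The positive part of [g + g' - 1], almost surely equal to it, keeps all integrands
   nonnegative. *)
pose p w := (Num.max (g w + g' w - 1) 0)%R.
have p0 w : (0 <= p w)%R by rewrite le_max lexx orbT.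
have mp : measurable_fun setT p.
  apply: measurable_maxr => //; apply: measurable_funB => //.
  exact: measurable_funD.
have ae_p : \int[P]_w (g w + g' w)%:E = \int[P]_w (p w + 1)%:E.
  apply: ge0_ae_eq_integral => //.
  - by apply/measurable_EFinP; exact: measurable_funD.
  - by apply/measurable_EFinP; exact: measurable_funD.
  - by move=> w _; rewrite lee_fin addr_ge0.
  - by move=> w _; rewrite lee_fin addr_ge0.
  exists N; split => // w /= /not_implyP[_ neq]; apply: contrapT => Nw.
  apply: neq; congr EFin; rewrite /p max_l ?subrK// subr_ge0.
  by have := fg w Nw; have := fg' w Nw; lra.
have pE : \int[P]_w (p w + 1)%:E = \int[P]_w (p w)%:E + 1.
  under eq_integral do rewrite EFinD.
  rewrite ge0_integralD//; [|by move=> w _;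
    rewrite lee_fin|exact/measurable_EFinP].
  by congr (_ + _); rewrite integral_cst//= probability_setT mule1.
have p_eq0 : \int[P]_w (p w)%:E = 0.
  apply/eqP; rewrite eq_le integral_ge0 ?andbT; last by move=> w _;
    rewrite lee_fin.
  by have := sum_le; rewrite ae_p pE -[X in _ <= X]add0e leeD2rE.
have [N2 [mN2 PN2 pN2]] : ae_eq P setT (EFin \o p) (cst 0).
  apply/ae_eq_integral_abs => //; first exact/measurable_EFinP.
  by rewrite -[RHS]p_eq0; apply: eq_integral => w _; rewrite /= ger0_norm.
have fE w : ~ N w -> ~ N2 w -> f w = g w.
  move=> Nw N2w; have /eqP : p w = 0%R.
    apply: contrapT => pw; apply: N2w; apply: pN2 => /= /(_ Logic.I) [] //.
  have f1 := fg w Nw; have f2 := fg' w Nw.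
  by rewrite /p => /eqP; have [le0 _|lt0 ?] := leP (g w + g' w - 1)%R 0%R; lra.
exists g; split => //.
- exists (N `|` N2); split; first exact: measurableU.
    by rewrite measureU0.
  move=> w /= neq; apply: contrapT => /not_orP[Nw N2w]; apply: neq.
  exact: fE.
apply/eqP; rewrite eq_le gx /=.
have g'fin : \int[P]_w (g' w)%:E \is a fin_num.
  rewrite ge0_fin_numE ?integral_ge0//; last by move=> w _; rewrite lee_fin.
  by rewrite (le_lt_trans gx')// ltry.
have : \int[P]_w (g w)%:E + \int[P]_w (g' w)%:E = 1.
  rewrite -ge0_integralD//; do ?[by move=> w _; rewrite lee_fin].
  by rewrite -[RHS]add0e -p_eq0 -pE -ae_p; apply: eq_integral => w _;
    rewrite EFinD.
move=> sum1; rewrite -(@leeD2rE _ (\int[P]_w (g' w)%:E))// sum1.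
by rewrite (le_trans (leeD2l _ gx'))// -EFinD lee_fin addrC subrK.
Qed.

End squeeze.

Section discounted_event_values.
Context d (Om : measurableType d) (R : realType) (P : probability Om R).
Variables (Y : nat -> {RV P >-> R}) (rec : bool) (a del D : R) (N : nat).
Hypothesis (D01 : 0 < D <= 1).
Local Open Scope ereal_scope.

Let D0 : (0 < D)%R. Proof. by case/andP: D01. Qed.

Lemma discounted_event_at w k : event_at rec a del (fun i => Y i w) k N ->
  discounted_event Y rec a del D N w = (D ^+ k.+1)%:E.
Proof.
move=> ek; rewrite /discounted_event (@nneseriesD1 _ _ k)//; last first.
  by move=> i _; rewrite lee_fin mulr_ge0 ?ler0n// exprn_ge0// ltW.
rewrite ek mulr1 eseries0 ?adde0// => i _ ik.
case: (boolP (event_at _ _ _ _ _ _)) => [ei|]; last by rewrite mulr0.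
by rewrite (event_at_uniq ei ek) eqxx in ik.
Qed.

Lemma discounted_event_cases w :
  (exists2 k, event_at rec a del (fun i => Y i w) k N &
    discounted_event Y rec a del D N w = (D ^+ k.+1)%:E) \/
  discounted_event Y rec a del D N w = 0.
Proof.
have [[k ek]|/forallNP nev] := pselect
  (exists k, event_at rec a del (fun i => Y i w) k N).
  by left; exists k => //; exact: discounted_event_at.
right; rewrite /discounted_event eseries0// => i _ _.
by case: (boolP (event_at _ _ _ _ _ _)) => [/nev //|]; rewrite mulr0.
Qed.

Lemma discounted_event01 w : 0 <= discounted_event Y rec a del D N w <= 1.
Proof.
have [[k _ ->]|->] := discounted_event_cases w; last by rewrite lexx lee01.
rewrite !lee_fin exprn_ge0 ?(ltW D0)//= exprn_ile1 ?(ltW D0)//.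
by case/andP: D01.
Qed.

Lemma measurable_discounted_event :
  measurable_fun setT (discounted_event Y rec a del D N).
Proof.
apply: (ge0_emeasurable_sum (P := xpredT)
  (h := fun k w => (D ^+ k.+1 * (event_at rec a del (fun i => Y i w) k
    N)%:R)%:E)).
  by move=> k w _ _; rewrite lee_fin mulr_ge0 ?ler0n// exprn_ge0// ltW.
move=> k _; apply/measurable_EFinP; apply: measurable_funM => //.
apply: (measurableT_comp (f := fun b : bool => b%:R : R)) => //.
exact: (measurable_event_at rec a del (Y := fun i w => Y i w)).
Qed.

End discounted_event_values.

(** The value at [+oo] is the limit of the exponential; event times are nonnegative, so [-oo] does
    not occur. *)
Definition discount (R : realType) (q : R) (t : \bar R) : R :=
  if t is s%:E then expR (- q * s) else 0.

Section discount.
Variables (R : realType) (q : R).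
Hypothesis q0 : 0 < q.

Lemma discount_ge0 t : 0 <= discount q t.
Proof. by case: t => //= s; exact: expR_ge0. Qed.

Lemma discount_le1 t : (0 <= t)%E -> discount q t <= 1.
Proof.
case: t => //= s; rewrite lee_fin => s0.
by rewrite -expR0 ler_expR mulNr oppr_le0 mulr_ge0// ltW.
Qed.

Lemma discount_le (s : R) t : (t <= s%:E)%E -> (0 <= t)%E ->
  expR (- q * s) <= discount q t.
Proof.
by case: t => //= t; rewrite !lee_fin => ts _;
  rewrite ler_expR !mulNr lerN2 ler_pM2l.
Qed.

End discount.

Section event_time_laplace.
Context (R : realType) (d : measure_display) (Om : measurableType d).
Variables (Q : probability Om R) (W : R -> {RV Q >-> R}) (r sigma : R).
Variables (rec : bool) (a q : R) (N : nat).
Hypotheses (a0 : 0 < a) (q0 : 0 < q).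

Let X := log_price r sigma (fun t w => W t w).
Let skel a' := skeleton_discount W r sigma rec a'.
Let f w := discount q (event_time rec a (fun t => X t w) N.+1).

Let mesh_D n : 0 < expR (- q * mesh R n) <= 1.
Proof.
by rewrite expR_gt0 -expR0 ler_expR mulNr oppr_le0 mulr_ge0 ?ltW// mesh_gt0.
Qed.

Let mesh_D_exp n k :
  expR (- q * mesh R n) ^+ k.+1 = expR (- q * (k.+1%:R * mesh R n)).
Proof. by rewrite -expRM_natl; congr expR; ring. Qed.

Section path.
Variable w : Om.
Hypotheses (X0 : X 0 w = 0).
Hypothesis (cX : {within `[0, +oo[, continuous (fun t => X t w)}).

(** With reduced size and negative margin the walk registers the event at most one mesh step after
    the path. *)
Lemma skeleton_discount_liminf e : 0 < e < a ->
  ((f w)%:E <= limn_einf (fun n => skel (a - e) (- e) q N n w))%E.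
Proof.
move=> /andP[e0 ea]; rewrite /f.
have := event_time_ge0 rec (fun t => X t w) N.+1 a0.
case tE : (event_time _ _ _ _) => [t||] //; last first.
  move=> _; apply: le_limn_einf; apply: nearW => n.
  by have /andP[] := discounted_event01 (skeleton_RV W r sigma n) rec (a - e)
    (- e) N (mesh_D n) w.
rewrite lee_fin [discount _ _]/= => t0.
apply/lee_addgt0Pr => eps eps0.
rewrite addeC -leeBlDl//.
apply: le_limn_einf.
have e20 : 0 < e / 2 by rewrite divr_gt0.
have osc := osc_lt_near cX (t + 2) e20.
have qeps : 0 < eps / q by rewrite divr_gt0.
near=> n.
have n1 : mesh R n <= 1 by rewrite /mesh invf_le1// ler1n.
(* Size and margin must each absorb twice the oscillation, hence [e / 2]; the horizon [t + 2] leaves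
   room for two mesh steps of length at most 1. *)
have [||||||k evk kt] := skeleton_le_event_time X0 (mesh_gt0 R n) a0
    (a' := a - e) (del := e) (w := e / 2) (T := t + 2) _ _ _ _ _ tE.
- by rewrite subr_gt0.
- by rewrite mulrC divfK// subrK.
- by rewrite mulrC divfK.
- exact: ltW.
- by near: n.
- by rewrite lerD2l ler_piMr.
rewrite /skel /skeleton_discount (discounted_event_at (Y := skeleton_RV W r
  sigma n) (w := w) (mesh_D n) evk).
rewrite -EFinB lee_fin mesh_D_exp.
have qh : q * mesh R n <= eps.
  rewrite -ler_pdivlMl// mulrC; apply: ltW.
  near: n; exact: near_infty_natSinv_lt (PosNum qeps).
have : expR (- q * (t + mesh R n)) <= expR (- q * (k.+1%:R * mesh R n)).
  by rewrite ler_expR !mulNr lerN2 ler_pM2l.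
apply: le_trans; rewrite mulrDr expRD.
have e1 := expR_ge1Dx (- q * mesh R n).
have e2 : expR (- q * t) <= 1 by rewrite -expR0 ler_expR mulNr oppr_le0
  mulr_ge0// ltW.
have e3 := expR_ge0 (- q * t).
rewrite lerBlDr -lerBlDl -{1}[expR (- q * t)]mulr1 -mulrBr.
have : 1 - expR (- q * mesh R n) <= eps.
  by rewrite lerBlDl -lerBlDr (le_trans _ e1)// mulNr lerD2l lerN2.
move=> le_eps; apply: (@le_trans _ _ (expR (- q * t) * eps)).
  by rewrite ler_wpM2l.
by rewrite ler_piMl// ltW.
Unshelve. all: by end_near. Qed.

(** An upper bound on the limit superior, written for the complements to 1: this is the form to
    which Fatou's lemma and [integral_squeeze] apply. *)
Lemma skeleton_discount_limsup e : 0 < e ->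
  ((1 - f w)%:E <= limn_einf (fun n => 1 - skel a e q N n w))%E.
Proof.
move=> e0; rewrite /f.
set tau := event_time _ _ _ _.
have tau0 : (0 <= tau)%E by exact: event_time_ge0.
apply/lee_addgt0Pr => eps eps0.
rewrite addeC -leeBlDl//.
apply: le_limn_einf.
(* Oscillations are controlled on compact intervals only; events of the walk after this [T] are
   discounted by at most [eps]. *)
pose T := Num.max 0 (- ln eps / q).
have T0 : 0 <= T by rewrite le_max lexx.
have Teps : expR (- q * T) <= eps.
  rewrite -[leRHS]lnK ?posrE// ler_expR mulNr lerNl.
  by rewrite -ler_pdivrMl// mulrC le_max lexx orbT.
have osc := osc_lt_near cX T e0.
near=> n.
have D01 := mesh_D n.
have [[k ek kE]|zE] := discounted_event_cases (skeleton_RV W r sigma n) rec a e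
  N D01 w;
  rewrite /skel /skeleton_discount ?kE ?zE; last first.
  rewrite sube0 -EFinB lee_fin lerBlDr.
  have := discount_ge0 q tau; lra.
rewrite -!EFinB lee_fin mesh_D_exp.
have [kT|Tk] := leP (k.+1%:R * mesh R n) T.
  have osc_n : osc_lt (fun t => X t w) T (mesh R n) e by near: n.
  have tk := event_time_le_skeleton X0 (mesh_gt0 R n) a0 T0 osc_n kT ek.
  have := discount_le q0 tk tau0; rewrite -/tau; lra.
have : expR (- q * (k.+1%:R * mesh R n)) <= expR (- q * T).
  by rewrite ler_expR !mulNr lerN2 ler_pM2l// ltW.
have := discount_ge0 q tau; lra.
Unshelve. all: by end_near. Qed.

End path.

End event_time_laplace.

Section perturbation.
Variables (R : realType).

Section cvg.
Context (F : set_system R) {FF : ProperFilter F}.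

Lemma cvg_expR_mul (b y : R -> R) (b0 y0 : R) :
  b @ F --> b0 -> y @ F --> y0 ->
  (fun e => expR (- b e * y e)) @ F --> expR (- b0 * y0).
Proof.
move=> bF yF; apply: (continuous_cvg _ (@continuous_expR R _)).
by apply: cvgM => //; exact: cvgN.
Qed.

Lemma cvg_pot (p m y : R -> R) (p0 m0 y0 : R) :
  p @ F --> p0 -> m @ F --> m0 -> y @ F --> y0 ->
  (fun e => pot (p e) (m e) (y e)) @ F --> pot p0 m0 y0.
Proof.
move=> pF mF yF; apply: cvgD.
  by apply: cvgM; [exact: cvgN|exact: cvg_expR_mul].
by apply: cvgM => //; exact: cvg_expR_mul.
Qed.

Lemma cvg_sqrt (u : R -> R) (u0 : R) : u @ F --> u0 ->
  (fun e => Num.sqrt (u e)) @ F --> Num.sqrt u0.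
Proof. by move=> uF; apply: (continuous_cvg _ (@sqrt_continuous R _)). Qed.

Lemma cvg_exprn (u : R -> R) (u0 : R) n : u @ F --> u0 ->
  (fun e => u e ^+ n) @ F --> u0 ^+ n.
Proof. by move=> uF; apply: (continuous_cvg _ (@exprn_continuous R n _)). Qed.

Lemma cvg_renewal rec (p m a del kap : R -> R) (p0 m0 a0 del0 kap0 : R) :
  0 < p0 -> m0 < 0 ->
  p @ F --> p0 -> m @ F --> m0 -> a @ F --> a0 -> del @ F --> del0 ->
  kap @ F --> kap0 ->
  (fun e => renewal (p e) (m e) rec (a e) (del e) (kap e)) @ F -->
  renewal p0 m0 rec a0 del0 kap0.
Proof.
move=> p00 m00 pF mF aF delF kapF.
have kF : (fun e => 2 * kap e) @ F --> 2 * kap0 by apply: cvgM => //;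
  exact: cvg_cst.
have akF : (fun e => a e + 2 * kap e) @ F --> a0 + 2 * kap0 by exact: cvgD.
apply: cvgM.
  case: rec; last exact: cvg_cst.
  by apply: cvg_expR_mul => //; exact: cvgD.
apply: cvgM; first exact: cvg_pot.
by apply: cvgV; [rewrite gt_eqF// pot_gt0|exact: cvg_pot].
Qed.

Lemma cvg_betap (r sigma : R) (q : R -> R) (q0 : R) : q @ F --> q0 ->
  (fun e => betap r sigma (q e)) @ F --> betap r sigma q0.
Proof.
move=> qF; apply: cvgM; last exact: cvg_cst.
apply: cvgD; first exact: cvg_cst.
apply: cvg_sqrt; apply: cvgD; first exact: cvg_cst.
by apply: cvgM; [apply: cvgM => //|]; exact: cvg_cst.
Qed.

Lemma cvg_betam (r sigma : R) (q : R -> R) (q0 : R) : q @ F --> q0 ->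
  (fun e => betam r sigma (q e)) @ F --> betam r sigma q0.
Proof.
move=> qF; apply: cvgM; last exact: cvg_cst.
apply: cvgB; first exact: cvg_cst.
apply: cvg_sqrt; apply: cvgD; first exact: cvg_cst.
by apply: cvgM; [apply: cvgM => //|]; exact: cvg_cst.
Qed.

End cvg.
End perturbation.

Section event_time_transform.
Context (R : realType) (d : measure_display) (Om : measurableType d).
Variables (Q : probability Om R) (W : R -> {RV Q >-> R}) (r sigma : R).
Variables (rec : bool) (a q : R) (N : nat).
Hypotheses (hW : standard_brownian_motion W) (sigma0 : 0 < sigma).
Hypotheses (a0 : 0 < a) (q0 : 0 < q).

Let X := log_price r sigma (fun t w => W t w).

Let bp := betap r sigma q.
Let bm := betam r sigma q.

Let bp0 : 0 < bp. Proof. exact: betap_gt0. Qed.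
Let bm0 : bm < 0. Proof. exact: betam_lt0. Qed.

Definition event_transform : R :=
  renewal bp bm rec a 0 0 ^+ N * (pot bp bm 0 / pot bp bm a).

Lemma good_paths : exists NN : set Om, [/\ measurable NN, Q NN = 0%E &
  forall w, ~ NN w -> X 0 w = 0 /\
    {within `[0, +oo[, continuous (fun t => X t w)}].
Proof.
have [N1 [mN1 QN1 sN1]] := bm_start hW;
  have [N2 [mN2 QN2 sN2]] := bm_continuous hW.
exists (N1 `|` N2); split; first exact: measurableU.
  by rewrite measureU0.
move=> w /not_orP[nN1 nN2].
have W0 : W 0 w = 0 by apply: contrapT => /sN1.
have cW : {within `[0, +oo[, continuous (fun t => W t w)} by apply: contrapT =>
  /sN2.
split; first by rewrite /X /log_price mulr0 W0 mulr0 addr0.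
move=> t; apply: cvgD; apply: cvgM; [exact: cvg_cst| |exact: cvg_cst|exact: cW].
exact: (continuous_subspaceT (fun x : R => @cvg_id _ (nbhs x))).
Qed.

Let upper e := renewal bp bm rec (a - e) (- e) 0 ^+ N *
  (pot bp bm 0 / pot bp bm (a - e)).

(** A single [e] serves as margin, as translation [kap] and as excess of the rate of the roots over
    the discount rate [q]. *)
Let lower e :=
  let p := betap r sigma (q + e) in let m := betam r sigma (q + e) in
  renewal p m rec a e e ^+ N *
  ((if rec then expR (- p * (e + e)) else 1) * pot p m e / pot p m (a + 2 * e)).

Let cvg_right_id : (fun e : R => e) @ 0^'+ --> (0 : R).
Proof. exact: cvg_at_right_filter (@cvg_id _ _). Qed.

Let upper_cvg : upper @ 0^'+ --> event_transform.
Proof.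
have aF : (fun e => a - e) @ 0^'+ --> a.
  by rewrite -[X in _ --> X]subr0; apply: cvgB => //; exact: cvg_cst.
have eF : (fun e : R => - e) @ 0^'+ --> (0 : R).
  by rewrite -[X in _ --> X]oppr0; exact: cvgN.
apply: cvgM.
  by apply: cvg_exprn; apply: cvg_renewal => //; exact: cvg_cst.
apply: cvgM; first exact: cvg_cst.
by apply: cvgV; [rewrite gt_eqF// pot_gt0|apply: cvg_pot => //; exact: cvg_cst].
Qed.

Let lower_cvg : lower @ 0^'+ --> event_transform.
Proof.
have qF : (fun e => q + e) @ 0^'+ --> q.
  by rewrite -[X in _ --> X]addr0; apply: cvgD => //; exact: cvg_cst.
have pF : (fun e => betap r sigma (q + e)) @ 0^'+ --> bp by exact: cvg_betap.
have mF : (fun e => betam r sigma (q + e)) @ 0^'+ --> bm by exact: cvg_betam.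
apply: cvgM.
  by apply: cvg_exprn; apply: cvg_renewal => //; exact: cvg_cst.
apply: cvgM; last first.
  apply: cvgV; [by rewrite gt_eqF// pot_gt0|apply: cvg_pot => //].
  rewrite -[X in _ --> X]addr0 -[X in _ --> _ + X](mulr0 2).
  by apply: cvgD; [exact: cvg_cst|apply: cvgM => //; exact: cvg_cst].
rewrite -[X in _ --> X]mul1r; apply: cvgM; last exact: cvg_pot.
case: (rec); last exact: cvg_cst.
have -> : (1 : R) = expR (- bp * (0 + 0)) by rewrite addr0 mulr0 expR0.
by apply: cvg_expR_mul => //; exact: cvgD.
Qed.

Lemma event_time_transform : exists g : Om -> R, [/\ measurable_fun setT g,
  forall w, 0 <= g w <= 1,
  {ae Q, forall w, discount q (event_time rec a (fun t => X t w) N.+1) = g w} &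
  (\int[Q]_w (g w)%:E = event_transform%:E)%E].
Proof.
have [NN [mNN QNN good]] := good_paths.
have D01 n : 0 < expR (- q * mesh R n) <= 1.
  by rewrite expR_gt0 -expR0 ler_expR mulNr oppr_le0 mulr_ge0 ?ltW// mesh_gt0.
have Z01 a' del n w := discounted_event01 (skeleton_RV W r sigma n) rec a' del
  N (D01 n) w.
have mZ a' del n := measurable_discounted_event (skeleton_RV W r sigma n) rec
  a' del N (D01 n).
apply: (integral_squeeze mNN QNN).
- by move=> w _; rewrite discount_ge0// discount_le1// event_time_ge0.
- move=> e e0.
  (* [x < a / 2] is the condition [- (a - x) < - x] imposed on the margin by the upper bound. *)
  have : \forall x \near 0^'+, upper x < event_transform + e /\ 0 < x < a / 2.
    move/cvgrPdist_lt : upper_cvg => /(_ _ e0) up; near=> x; split.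
      suff : `|event_transform - upper x| < e by rewrite ltr_norml => /andP[];
        lra.
      by near: x.
    apply/andP; split; near: x; first exact: nbhs_right_gt.
    by apply: nbhs_right_lt; rewrite divr_gt0.
  move=> /filter_ex[x /= [xe xa]].
  have /andP[x0 xa2] := xa; have xa' : x < a by lra.
  exists (fun w => limn_einf (fun n => skeleton_discount W r sigma rec (a - x)
    (- x) q N n w)).
  split.
  + by apply: measurable_fun_limn_einf => n; exact: mZ.
  + by move=> w; apply: le_limn_einf; apply: nearW => n;
      case/andP: (Z01 (a - x) (- x) n w).
  + move=> w /good[X0 cX]; apply: skeleton_discount_liminf => //.
    by rewrite x0.
  + apply: le_trans (fatou _ _ _ _) _ => //.
    * by move=> n; exact: mZ.
    * by move=> n w _; case/andP: (Z01 (a - x) (- x) n w).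
    apply: limn_einf_le; apply: nearW => n.
    have ax0 : 0 < a - x by rewrite subr_gt0.
    have xx : - (a - x) < - x < 0 by apply/andP; split; lra.
    apply: le_trans (integral_skeleton_discount_le r hW rec sigma0 ax0 N n q0
      xx) _.
    by rewrite lee_fin ltW.
- move=> e e0.
  have : \forall x \near 0^'+, event_transform - e < lower x /\ 0 < x.
    move/cvgrPdist_lt : lower_cvg => /(_ _ e0) low; near=> x; split.
      suff : `|event_transform - lower x| < e by rewrite ltr_norml => /andP[];
        lra.
      by near: x.
    by near: x; exact: nbhs_right_gt.
  move=> /filter_ex[x /= [xe x0]].
  exists (fun w => limn_einf (fun n => 1 - skeleton_discount W r sigma rec a x
    q N n w)%E).
  have mZ' n : measurable_fun setT (fun w => 1 - skeleton_discount W r sigma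
    rec a x q N n w)%E.
    by apply: emeasurable_funB => //; exact: mZ.
  have Zfin n w : skeleton_discount W r sigma rec a x q N n w \is a fin_num.
    have /andP[z0 z1] := Z01 a x n w.
    by rewrite ge0_fin_numE// (le_lt_trans z1)// ltry.
  have Z'0 n w : (0 <= 1 - skeleton_discount W r sigma rec a x q N n w)%E.
    by rewrite suber_ge0 ?Zfin//; case/andP: (Z01 a x n w).
  split.
  + exact: measurable_fun_limn_einf.
  + by move=> w; apply: le_limn_einf; apply: nearW => n; exact: Z'0.
  + by move=> w /good[X0 cX]; exact: skeleton_discount_limsup.
  + apply: le_trans (fatou _ _ _ _) _ => //.
    apply: limn_einf_le.
    have qx : 0 < q < q + x by rewrite q0 ltrDl.
    have := integral_skeleton_discount_ge r hW rec sigma0 a0 N qx (ltW x0) x0.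
    apply: filterS => n low.
    have sum1 : (\int[Q]_w (1 - skeleton_discount W r sigma rec a x q N n w) +
        \int[Q]_w skeleton_discount W r sigma rec a x q N n w = 1)%E.
      rewrite -ge0_integralD//; last 2 first.
      - by move=> w _; case/andP: (Z01 a x n w).
      - exact: mZ.
      under eq_integral do rewrite subeK//.
      by rewrite integral_cst//= probability_setT mule1.
    have Ifin : (\int[Q]_w skeleton_discount W r sigma rec a x q N n w)%E \is a
      fin_num.
      rewrite ge0_fin_numE; last by apply: integral_ge0 => w _;
        case/andP: (Z01 a x n w).
      rewrite (@le_lt_trans _ _ 1%E) ?ltry// -sum1 leeDr//.
      exact: integral_ge0.
    rewrite -(@leeD2rE _ (\int[Q]_w skeleton_discount W r sigma rec a x q N n
      w)%E)// sum1.
    apply: le_trans (leeD2l _ low).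
    by rewrite -EFinD lee_fin -/(lower x); lra.
Unshelve. all: by end_near. Qed.

End event_time_transform.

(** * Laplace transforms of the contract prices *)

Section lower_integral.
Context d (T : measurableType d) (R : realType) (mu : {measure set T -> \bar
  R}).
Local Open Scope ereal_scope.

Import HBNNSimple.

Lemma ge0_le_integral_nonmeasurable (f g : T -> \bar R) :
  (forall x, 0 <= f x) -> (forall x, f x <= g x) ->
  \int[mu]_x f x <= \int[mu]_x g x.
Proof.
move=> f0 fg; rewrite !ge0_integralTE//; last first.
  by move=> x; exact: le_trans (fg x).
apply: ereal_sup_le => _ [h hf <-].
by exists h => // x; exact: le_trans (fg x).
Qed.

(* [f] need not be measurable: the integral of a nonnegative function is the
   supremum of the integrals of the simple functions below it. *)
Lemma ge0_integral_eq_off_null (N : set T) (f g : T -> \bar R) :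
  measurable N -> mu N = 0 -> measurable_fun setT g ->
  (forall x, 0 <= f x) -> (forall x, 0 <= g x) ->
  (forall x, ~ N x -> f x = g x) -> \int[mu]_x f x = \int[mu]_x g x.
Proof.
move=> mN N0 mg f0 g0 fg.
have mNb : measurable_fun setT (fun x => x \in N).
  by apply: (measurable_fun_bool true); rewrite setTI (_ : _ @^-1` _ = N)//;
    apply/seteqP; split=> x /=; [exact: set_mem|exact: mem_set].
apply/eqP; rewrite eq_le; apply/andP; split.
(* Giving [g] the value [+oo] on [N] makes it a measurable majorant of [f]; the value 0 below makes
   it a minorant. *)
- pose g' x := if x \in N then +oo else g x.
  apply: (@le_trans _ _ (\int[mu]_x g' x)).
    apply: ge0_le_integral_nonmeasurable => // x; rewrite /g'.
    by case: ifPn => [_|]; rewrite ?leey// notin_setE => /fg ->.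
  rewrite le_eqVlt; apply/orP; left; apply/eqP; apply: ge0_ae_eq_integral => //.
  + exact: measurable_fun_ifT.
  + by move=> x _; rewrite /g'; case: ifP.
  + exists N; split => // x /= /not_implyP[_]; rewrite /g'.
    by case: ifPn => [/[!inE]|].
- pose g' x := if x \in N then 0 else g x.
  apply: (@le_trans _ _ (\int[mu]_x g' x)); last first.
    apply: ge0_le_integral_nonmeasurable => x; rewrite /g'; case: ifPn => //.
    by rewrite notin_setE => /fg ->.
  rewrite le_eqVlt; apply/orP; left; apply/eqP; apply: ge0_ae_eq_integral => //.
  + exact: measurable_fun_ifT.
  + by move=> x _; rewrite /g'; case: ifP.
  + exists N; split => // x /= /not_implyP[_]; rewrite /g'.
    by case: ifPn => [/[!inE]|].
Qed.

End lower_integral.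

Lemma integral_expR_tail (R : realType) (c s : R) : 0 < c ->
  (\int[lebesgue_measure]_(t in `[s, +oo[) (expR (- c * t))%:E =
   (expR (- c * s) / c)%:E)%E.
Proof.
move=> c0; pose F (t : R) := - (expR (- c * t) / c).
have dF (t : R) : is_derive t 1 F (expR (- c * t)).
  rewrite /F; apply: is_derive_eq.
  by rewrite /GRing.scale /=; field; rewrite gt_eqF.
have cexp : continuous (fun t : R => expR (- c * t)).
  move=> t; apply: (continuous_cvg _ (@continuous_expR R _)).
  by apply: cvgM; [exact: cvg_cst|exact: cvg_id].
rewrite (@ge0_continuous_FTC2y _ _ F s 0) ?sub0e ?oppeK//.
- by rewrite /F -EFinN opprK.
- exact: continuous_subspaceT.
- rewrite -oppr0 -(mul0r c^-1); apply: cvgN; apply: cvgM; last exact: cvg_cst.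
  rewrite (_ : (fun t => _) = (fun t => expR (- t)) \o (fun t => c * t));
    last first.
    by apply/funext => t /=; rewrite mulNr.
  by apply: cvg_comp (@cvgr_expR R); exact: gt0_cvgMry.
- apply: cvg_at_right_filter; apply: cvgN; apply: cvgM; last exact: cvg_cst.
  exact: cexp.
- by move=> t _; have dFt := dF t; rewrite derive1E; exact: derive_val.
Qed.

Section contracts_laplace.
Context (R : realType) (d : measure_display) (Om : measurableType d).
Variables (Q : probability Om R) (q : R) (tau : nat -> Om -> \bar R).
Variables (tau' : nat -> Om -> \bar R) (x : nat -> R) (N : set Om).
Hypotheses (q0 : 0 < q) (mN : measurable N) (QN : Q N = 0%E).
Hypotheses (mtau' : forall n, measurable_fun setT (tau' n)).
Hypotheses (tau'0 : forall n w, (0 <= tau' n w)%E).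
Hypotheses (tauE : forall n w, ~ N w -> tau n.+1 w = tau' n w).
Hypotheses (transform :
  forall n, (\int[Q]_w (discount q (tau' n w))%:E = (x n)%:E)%E).

Local Open Scope ereal_scope.

(** One kernel for both contracts: [c = q] discounts from maturity (type 1), [c = lambda] discounts
    the payment from the event time at rate [q - c = r] (type 2). Integrating over the maturity
    leaves [e^(- q tau) / c] in either case. *)
Let phi c n (z : R * Om) : R :=
  (expR (- c * z.1) * (expR (- (q - c) * fine (tau' n z.2)) *
     ((tau' n z.2 <= z.1%:E)%E)%:R))%R.

Let phi0 c n z : (0 <= phi c n z)%R.
Proof. by rewrite !mulr_ge0 ?expR_ge0. Qed.

Let mphi c n : measurable_fun setT (fun z : measurableTypeR R * Om => (phi c n
  z)%:E).
Proof.
apply/measurable_EFinP; apply: measurable_funM.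
  by apply: measurableT_comp => //; exact: measurable_funM.
apply: measurable_funM.
  apply: measurableT_comp => //; apply: measurable_funM => //.
  by apply: measurableT_comp => //; apply: measurableT_comp => //;
    exact: measurableT_comp.
apply: (measurableT_comp (f := fun b : bool => b%:R : R)) => //.
apply: measurable_fun_lee => //; first exact: measurableT_comp.
by apply/measurable_EFinP.
Qed.

Let measurable_discount_tau n : measurable_fun setT (fun w => discount q (tau'
  n w)).
Proof.
rewrite (_ : (fun _ => _) = fun w =>
    if (tau' n w < +oo)%E then expR (- q * fine (tau' n w)) else 0%R).
  apply: measurable_fun_ifT => //; first exact: measurable_fun_lte.
  apply: measurableT_comp => //; apply: measurable_funM => //.
  by apply: measurableT_comp => //; exact: measurable_fine.
apply/funext => w; have := tau'0 n w.
by case: (tau' n w) => [s|//|//] _; rewrite /= ltry.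
Qed.

Lemma integral_kernel c n : (0 < c)%R ->
  \int[lebesgue_measure]_(t in `[0%R, +oo[) \int[Q]_w (phi c n (t, w))%:E =
  (x n / c)%:E.
Proof.
move=> c0.
(* Negative maturities contribute nothing because [tau'] is nonnegative; the whole line is a product
   factor for Tonelli. *)
transitivity (\int[lebesgue_measure]_t \int[Q]_w (phi c n (t, w))%:E).
  rewrite integral_mkcond; apply: eq_integral => t _.
  rewrite patchE; case: ifPn => //;
    rewrite notin_setE /= in_itv /= andbT => /negP.
  rewrite -ltNge => t0; apply/esym; apply: integral0_eq => w _.
  rewrite /phi /= leNgt (lt_le_trans _ (tau'0 n w)) ?lte_fin//=.
  by rewrite !mulr0.
rewrite (fubini_tonelli (fun z : measurableTypeR R * Om => (phi c n z)%:E))//;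
  last first.
  by move=> z; rewrite lee_fin.
transitivity (\int[Q]_w ((discount q (tau' n w))%:E * (c^-1)%:E)).
  apply: eq_integral => w _; rewrite /phi /=.
  have := tau'0 n w; case: (tau' n w) => [s|_|//]; last first.
    rewrite integral0_eq ?mul0e// => t _.
    by rewrite leye_eq /= !mulr0.
  rewrite lee_fin => s0.
  transitivity (\int[lebesgue_measure]_(t in `[s, +oo[)
      ((expR (- (q - c) * s))%:E * (expR (- c * t))%:E)).
    rewrite [RHS]integral_mkcond; apply: eq_integral => t _.
    rewrite patchE lee_fin mem_setE in_itv /= andbT.
    by case: ifPn => _; rewrite ?mulr0// mulr1 EFinM muleC.
  rewrite ge0_integralZl//; last first.
    by apply/measurable_EFinP; apply: measurable_funTS; apply: measurableT_comp.
  rewrite integral_expR_tail// -!EFinM mulrA -expRD; congr (expR _ * _)%:E.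
  by ring.
rewrite ge0_integralZr//.
- by rewrite transform -EFinM.
- apply/measurable_EFinP; exact: measurable_discount_tau.
- by move=> w _; rewrite lee_fin discount_ge0.
- by rewrite lee_fin invr_ge0 ltW.
Qed.

Let mphi_w c n t : measurable_fun setT (fun w => (phi c n (t, w))%:E).
Proof. exact: (measurableT_comp (mphi c n) (measurable_pair1 t)). Qed.

Let kernel_ge0 c n t : 0 <= \int[Q]_w (phi c n (t, w))%:E.
Proof. by apply: integral_ge0 => w _; rewrite lee_fin. Qed.

Let mkernel c n : measurable_fun setT
  (fun t : measurableTypeR R => \int[Q]_w (phi c n (t, w))%:E).
Proof.
apply: (measurable_fun_fubini_tonelli_F (m2 := Q)
  (fun z : measurableTypeR R * Om => (phi c n z)%:E)) => // z.
by rewrite lee_fin.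
Qed.

Lemma laplace_kernel c : (0 < c)%R ->
  \int[lebesgue_measure]_(t in `[0%R, +oo[)
    (\sum_(n <oo) \int[Q]_w (phi c n (t, w))%:E) =
  \sum_(n <oo) (x n / c)%:E.
Proof.
move=> c0; rewrite integral_nneseries//.
- by apply: eq_eseriesr => n _; rewrite integral_kernel.
- by move=> n; apply: measurable_funTS; exact: mkernel.
Qed.

Let indic_le_tau k t w : \1_[set w' | tau k w' <= t%:E] w =
  ((tau k w <= t%:E)%E)%:R :> R.
Proof. by rewrite indicE; congr (nat_of_bool _)%:R; apply/idP/idP;
  rewrite inE. Qed.

Let price_type1_kernel t lambda r : q = (lambda + r)%R ->
  (expR (- lambda * t))%:E * price_type1 Q r tau t =
  \sum_(n <oo) \int[Q]_w (phi q n (t, w))%:E.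
Proof.
move=> qE; rewrite /price_type1 muleA -EFinM -expRD -mulrDl -opprD -qE.
pose ind n w : \bar R := ((tau' n w <= t%:E)%E)%:R%:E.
have mind n : measurable_fun setT (ind n).
  apply/measurable_EFinP.
  apply: (measurableT_comp (f := fun b : bool => b%:R : R)) => //.
  by apply: measurable_fun_lee.
have -> : \int[Q]_w event_count tau t w = \int[Q]_w (\sum_(n <oo) ind n w).
  apply: (ge0_integral_eq_off_null mN) => //.
  - by apply: (ge0_emeasurable_sum (P := xpredT) (h := ind)) => // k w _ _;
      rewrite lee_fin.
  - by move=> w; apply: nneseries_ge0 => n _ _; rewrite lee_fin.
  - by move=> w; apply: nneseries_ge0 => n _ _; rewrite lee_fin.
  - move=> w Nw; rewrite /event_count -(nneseries_addn 1); last first.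
      by move=> n; rewrite lee_fin.
    by apply: eq_eseriesr => n _; rewrite addn1 indic_le_tau (tauE n Nw).
rewrite integral_nneseries//; last by move=> n w _; rewrite lee_fin.
rewrite -nneseriesZl; last first.
  by move=> n _; apply: integral_ge0 => w _; rewrite /ind lee_fin.
apply: eq_eseriesr => n _; rewrite -ge0_integralZl//; last first.
  by move=> w _; rewrite lee_fin.
by apply: eq_integral => w _; rewrite /phi /= subrr oppr0 mul0r expR0 mul1r.
Qed.

Let price_type2_kernel t lambda r : q = (lambda + r)%R ->
  (expR (- lambda * t))%:E * price_type2 Q r tau t =
  \sum_(n <oo) \int[Q]_w (phi lambda n (t, w))%:E.
Proof.
move=> qE; rewrite /price_type2.
pose pay n w : \bar R :=
  (expR (- r * fine (tau' n w)) * ((tau' n w <= t%:E)%E)%:R)%:E.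
have mpay n : measurable_fun setT (pay n).
  apply/measurable_EFinP; apply: measurable_funM.
    apply: measurableT_comp => //; apply: measurable_funM => //.
    by apply: measurableT_comp => //; exact: measurable_fine.
  apply: (measurableT_comp (f := fun b : bool => b%:R : R)) => //.
  by apply: measurable_fun_lee.
have -> : \sum_(1 <= k <oo) 'E_Q[(fun w => expR (- r * fine (tau k w)) *
      \1_[set w' | (tau k w' <= t%:E)%E] w)%R] = \sum_(n <oo) \int[Q]_w pay n w.
  rewrite -(nneseries_addn 1); last first.
    move=> n; rewrite unlock; apply: integral_ge0 => w _.
    by rewrite lee_fin mulr_ge0 ?expR_ge0.
  apply: eq_eseriesr => n _; rewrite unlock.
  apply: (ge0_integral_eq_off_null mN) => //.
  - by move=> w; rewrite lee_fin mulr_ge0 ?expR_ge0.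
  - by move=> w Nw; rewrite addn1 indic_le_tau (tauE n Nw).
rewrite -nneseriesZl; last first.
  by move=> n _; apply: integral_ge0 => w _;
    rewrite /pay lee_fin mulr_ge0 ?expR_ge0.
apply: eq_eseriesr => n _; rewrite -ge0_integralZl//; last first.
  by move=> w _; rewrite /pay lee_fin mulr_ge0 ?expR_ge0.
by apply: eq_integral => w _; rewrite /phi /= -EFinM qE addrC addKr.
Qed.

Lemma laplace_price_type1 lambda r : q = (lambda + r)%R ->
  laplace (price_type1 Q r tau) lambda = \sum_(n <oo) (x n / q)%:E.
Proof.
move=> qE; rewrite /laplace -laplace_kernel//.
by apply: eq_integral => t _; exact: price_type1_kernel.
Qed.

Lemma laplace_price_type2 lambda r : q = (lambda + r)%R -> (0 < lambda)%R ->
  laplace (price_type2 Q r tau) lambda = \sum_(n <oo) (x n / lambda)%:E.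
Proof.
move=> qE l0; rewrite /laplace -laplace_kernel//.
by apply: eq_integral => t _; exact: price_type2_kernel.
Qed.

End contracts_laplace.

Lemma geometric_nneseries (R : realType) (y b : R) : 0 <= y < 1 -> 0 <= b ->
  (\sum_(n <oo) (y ^+ n * b)%:E = (b / (1 - y))%:E)%E.
Proof.
move=> /andP[y0 y1] b0; apply/cvg_lim => //.
have -> : (fun n => \sum_(0 <= k < n) (y ^+ k * b)%:E)%E =
    EFin \o series (geometric b y).
  apply/funext => n; rewrite /= sumEFin; congr EFin.
  by apply: eq_bigr => k _; rewrite mulrC.
apply: cvg_EFin; first exact: nearW.
by apply: cvg_geometric_series; rewrite ger0_norm.
Qed.

Section contract_prices.
Context (R : realType) (d : measure_display) (Om : measurableType d).
Variables (Q : probability Om R) (W : R -> {RV Q >-> R}) (r sigma a q : R).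
Hypotheses (hW : standard_brownian_motion W) (sigma0 : 0 < sigma).
Hypotheses (a0 : 0 < a) (q0 : 0 < q).

Let X := log_price r sigma (fun t w => W t w).
Let bp := betap r sigma q.
Let bm := betam r sigma q.

Let bp0 : 0 < bp. Proof. exact: betap_gt0. Qed.
Let bm0 : bm < 0. Proof. exact: betam_lt0. Qed.

Let ratio : R := cbar r sigma a q / bbar r sigma a q.

Let exp_lt : expR (- bp * a) < expR (- bm * a).
Proof. by rewrite ltr_expR ltr_pM2r// ltrN2 (lt_trans bm0). Qed.

Let pot_lt : pot bp bm 0 < pot bp bm a.
Proof.
rewrite pot0 /pot.
have -> : bp - bm = - bm * (1 + - bp * a) + bp * (1 + - bm * a) by ring.
have ne1 : - bp * a != 0 by rewrite mulf_neq0 ?oppr_eq0 ?gt_eqF.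
have ne2 : - bm * a != 0 by rewrite mulf_neq0 ?oppr_eq0 ?(lt_eqF bm0)// gt_eqF.
by rewrite ltrD// ltr_pM2l ?oppr_gt0// expR_gt1Dx.
Qed.

Let ratioE : ratio = pot bp bm 0 / pot bp bm a.
Proof.
rewrite /ratio /cbar /bbar -/bp -/bm pot0.
have den : expR (- bm * a) - expR (- bp * a) != 0 by rewrite gt_eqF// subr_gt0.
have -> : bp * expR (- bm * a) - bm * expR (- bp * a) = pot bp bm a.
  by rewrite /pot; ring.
by rewrite invf_div mulrA divfK.
Qed.

Let ratio01 : 0 <= ratio < 1.
Proof.
rewrite ratioE divr_ge0 ?ltW ?pot_gt0//=.
by rewrite ltr_pdivrMr ?mul1r ?pot_gt0.
Qed.

(** Measurable versions of the event times are recovered by inverting the discount on the measurable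
    version [g], with [+oo] where it vanishes; one null set serves all events. *)
Lemma event_time_representation rec : exists (N : set Om) (tau : nat -> Om ->
  \bar R),
  [/\ measurable N /\ Q N = 0%E, forall n, measurable_fun setT (tau n),
      forall n w, (0 <= tau n w)%E,
      forall w, ~ N w -> {within `[0, +oo[, continuous (fun t => X t w)} /\
        forall n, event_time rec a (fun t => X t w) n.+1 = tau n w &
      forall n, (\int[Q]_w (discount q (tau n w))%:E =
        (event_transform r sigma rec a q n)%:E)%E].
Proof.
have [N0 [mN0 QN0 good]] := good_paths r sigma hW.
have /choice[g gP] := fun n => event_time_transform r rec n hW sigma0 a0 q0.
have : Q.-negligible (N0 `|` \bigcup_n
    [set w | discount q (event_time rec a (fun t => X t w) n.+1) <> g n w]).
  apply: negligibleU; first by exists N0; split.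
  by apply: negligible_bigcup => n; case: (gP n).
move=> [N [mN QN sN]].
exists N, (fun n w => if 0 < g n w then (- ln (g n w) / q)%:E else +oo%E).
have discE n w : discount q (if 0 < g n w then (- ln (g n w) / q)%:E else
  +oo%E) = g n w.
  case: (gP n) => _ /(_ w)/andP[g0 _] _ _.
  case: ifPn => [gpos|]; last by rewrite -leNgt => gle; apply/le_anti;
    rewrite g0 gle.
  by rewrite /= mulNr mulrC divfK ?opprK ?lnK// gt_eqF.
split.
- by [].
- move=> n; have [mg _ _ _] := gP n; apply: measurable_fun_ifT => //.
    exact: measurable_fun_ltr.
  apply/measurable_EFinP; apply: measurable_funM => //.
  by apply: measurable_funN; exact: measurableT_comp.
- move=> n w; case: ifP => // gpos;
    rewrite lee_fin divr_ge0 ?(ltW q0)// oppr_ge0.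
  by rewrite ln_le0//; case: (gP n) => _ /(_ w)/andP[].
- move=> w Nw.
  have Nw0 : ~ N0 w by move=> N0w; apply: Nw; apply: sN; left.
  split; first by have [] := good w Nw0.
  move=> n; have gE : discount q (event_time rec a (fun t => X t w) n.+1) = g n
    w.
    by apply: contrapT => neq; apply: Nw; apply: sN; right; exists n.
  rewrite -gE; have := event_time_ge0 rec (fun t => X t w) n.+1 a0.
  case: (event_time _ _ _ _) => [t||]; rewrite ?ltxx //= => _.
  by rewrite expR_gt0 expRK; congr EFin; field; rewrite gt_eqF.
- move=> n; under eq_integral do rewrite discE.
  by case: (gP n).
Qed.

Let decay rec : R := if rec then expR (- bp * a) else 1.

Let event_transformE rec n :
  event_transform r sigma rec a q n = (decay rec * ratio) ^+ n * ratio.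
Proof.
rewrite /event_transform /renewal -/bp -/bm -/ratio mulr0 !addr0 -ratioE.
by [].
Qed.

Let sum_transform rec c : 0 < c ->
  (\sum_(n <oo) (event_transform r sigma rec a q n / c)%:E =
   (1 / c * (ratio / (1 - decay rec * ratio)))%:E)%E.
Proof.
move=> c0; have /andP[ratio0 ratio1] := ratio01.
under eq_eseriesr do rewrite event_transformE -mulrA.
rewrite geometric_nneseries.
- by congr EFin; ring.
- have decay0 : 0 <= decay rec by rewrite /decay; case: (rec);
    rewrite ?expR_ge0.
  have decay1 : decay rec <= 1.
    rewrite /decay; case: (rec) => //.
    by rewrite -expR0 ler_expR mulNr oppr_le0 mulr_ge0// ltW.
  by rewrite mulr_ge0//= (le_lt_trans _ ratio1)// ler_piMl.
- by rewrite divr_ge0// ltW.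
Qed.

Lemma laplace_price rec (tau : nat -> Om -> \bar R) lambda :
  q = lambda + r -> 0 < lambda ->
  (forall w, {within `[0, +oo[, continuous (fun t => X t w)} ->
     forall n, tau n w = event_time rec a (fun t => X t w) n) ->
  laplace (price_type1 Q r tau) lambda =
    (1 / q * (ratio / (1 - decay rec * ratio)))%:E /\
  laplace (price_type2 Q r tau) lambda =
    (1 / lambda * (ratio / (1 - decay rec * ratio)))%:E.
Proof.
move=> qE l0 tauE; have [N [tau' [[mN QN] mtau' tau'0 tauN tr]]] :=
  event_time_representation rec.
have tauE' n w : ~ N w -> tau n.+1 w = tau' n w.
  by move=> /tauN[cX eq_tau]; rewrite (tauE w cX).
split.
  by rewrite (laplace_price_type1 q0 mN QN mtau' tau'0 tauE' tr qE)
    sum_transform.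
by rewrite (laplace_price_type2 mN QN mtau' tau'0 tauE' tr qE l0) sum_transform.
Qed.

End contract_prices.

Theorem corollary5p1 (R : realType) (d : measure_display)
    (Om : measurableType d) (Q : probability Om R) (W : R -> {RV Q >-> R})
    (r sigma alpha : R)
    (hW : standard_brownian_motion W)
    (hr : 0 < r) (hsigma : 0 < sigma) (halpha : 0 < alpha < 1) :
  let X := log_price r sigma (fun t w => W t w) in
  let abar := - ln (1 - alpha) in
  let beta_p := betap r sigma in
  let b := bbar r sigma abar in
  let c := cbar r sigma abar in
  forall lambda : R, 0 < lambda ->
  let q := lambda + r in
  [/\ laplace (V1 Q r abar X) lambda =
        (1 / q * ((c q / b q) / (1 - c q / b q)))%:E,
      laplace (V1_recovery Q r abar X) lambda =
        (1 / q * ((c q / b q) /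
                  (1 - expR (- beta_p q * abar) * (c q / b q))))%:E,
      laplace (V2 Q r abar X) lambda =
        (1 / lambda * ((c q / b q) / (1 - c q / b q)))%:E
    & laplace (V2_recovery Q r abar X) lambda =
        (1 / lambda * ((c q / b q) /
                       (1 - expR (- beta_p q * abar) * (c q / b q))))%:E].
Proof.
move=> X abar beta_p b c lambda l0 q.
have abar0 : 0 < abar.
  case/andP: halpha => al0 al1.
  by rewrite oppr_gt0 ln_lt0// subr_gt0 al1 ltrBlDr ltrDl.
have q0 : 0 < q by rewrite addr_gt0.
have noE w : {within `[0, +oo[, continuous (fun t => X t w)} ->
    forall n, drawdown_time abar (fun t => X t w) n =
      event_time false abar (fun t => X t w) n.
  by move=> cX n; exact: drawdown_timeE.
have recE w : {within `[0, +oo[, continuous (fun t => X t w)} ->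
    forall n, recovery_drawdown_time abar (fun t => X t w) n =
      event_time true abar (fun t => X t w) n.
  by move=> cX n; exact: recovery_drawdown_timeE.
have [V1E V2E] := laplace_price hW hsigma abar0 q0 (erefl q) l0 noE.
have [V1E' V2E'] := laplace_price hW hsigma abar0 q0 (erefl q) l0 recE.
have one_mul (y : R) : 1 - 1 * y = 1 - y by rewrite mul1r.
by rewrite one_mul in V1E V2E; split.
Qed.
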